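(* Let $r\ge 1$, $\alpha_1,\dots,\alpha_r\in\mathbb{C}\smallsetminus\mathbb{R}$, $k_1,\dots,k_r\in\mathbb{N}$ (positive integers), $\mathcal{S}=\{(\alpha_1,k_1),\dots,(\alpha_r,k_r)\}$ (a multiset), and $m=4(k_1+\dots+k_r)$. Then the nonsingular $2$-step algebra $\mu_{\mathcal{S}}$ of type $(2,m)$ admits a nilsoliton inner product if and only if $k_1=\dots=k_r=1$.
   Context: Let $\mathfrak{n}=\mathfrak{n}_1\oplus\mathfrak{n}_2$ be a real inner product space with orthonormal bases $\{X_1,\dots,X_m\}$ of $\mathfrak{n}_1$ and $\{Z_1,Z_2\}$ of $\mathfrak{n}_2$, $\mathfrak{n}_1\perp\mathfrak{n}_2$. A bilinear skew-symmetric map $\mu:\mathfrak{n}_1\times\mathfrak{n}_1\to\mathfrak{n}_2$ is regarded as a $2$-step nilpotent Lie bracket on $\mathfrak{n}$ (with $\mathfrak{n}_2$ central); it is of type $(2,m)$ if $\mu(\mathfrak{n}_1,\mathfrak{n}_1)=\mathfrak{n}_2$. It is determined by the linear map $J_\mu:\mathfrak{n}_2\to\mathfrak{so}(\mathfrak{n}_1)$, $\langle J_\mu(Z)X,Y\rangle=\langle\mu(X,Y),Z\rangle$. It is nonsingular if $J_\mu(Z)$ is invertible for all $Z\neq 0$. Definition of $\mu_{\mathcal{S}}$: the matrix of $J_{\mu_{\mathcal{S}}}(xZ_1+yZ_2)$ with respect to $\{X_i\}$ is block diagonal with one diagonal block for each element of $\mathcal{S}$. The block attached to $(a+\mathrm{i}b,k)$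 ($a,b\in\mathbb{R}$, $b\ne 0$) is the $4k\times4k$ matrix $\begin{bmatrix} 0 & A \\ -A^t & 0 \end{bmatrix}$, where $A$ is the $2k\times 2k$ matrix partitioned into $2\times 2$ blocks $A_{ij}$, $1\le i,j\le k$, with $$A_{ij}=\begin{bmatrix} -bx & y-ax \\ y-ax & bx \end{bmatrix}\ (i+j=k+1),\quad A_{ij}=\begin{bmatrix} 0 & x \\ x & 0 \end{bmatrix}\ (i+j=k+2),\quad A_{ij}=0\text{ otherwise}.$$ Every such $\mu_{\mathcal{S}}$ is nonsingular. An inner product on $\mathfrak{n}$ is called a nilsoliton for $(\mathfrak{n},\mu)$ if the left-invariant Riemannian metric $g$ it determines on the simply connected nilpotent Lie group with Lie algebra $(\mathfrak{n},\mu)$ is a Ricci soliton, i.e. the Ricci flow solution starting at $g$ evolves only by time-dependent scaling and pull-back by diffeomorphisms. In this setting this is known to be equivalent to: the Ricci operator of $g$ equals $cI+D$ for some $c\in\mathbb{R}$ and some derivation $D$ of $(\mathfrak{n},\mu)$. ''Admits'' means that some inner product on $\mathfrak{n}$ has this property. *)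

(* Defs.v *)
From mathcomp Require Import all_boot all_order all_algebra.
From mathcomp Require Import reals.
From mathcomp.real_closed Require Export complex.

Set Implicit Arguments.
Unset Strict Implicit.
Unset Printing Implicit Defensive.

Import Order.TTheory GRing.Theory Num.Theory.

Local Open Scope ring_scope.

(* Left-invariant Riemannian geometry: a tensor that is invariant under left
   translations is identified with its value at the neutral element, so metrics
   are positive definite forms on the Lie algebra and covariant derivatives of
   left-invariant fields are bilinear products on it. *)

Definition is_levi_civita (R : realType) (n : nat)
    (br : 'rV[R]_n -> 'rV[R]_n -> 'rV[R]_n) (g : {dot 'rV[R]_n for idfun})
    (nabla : {bilinear 'rV[R]_n -> 'rV[R]_n -> 'rV[R]_n}) : Prop :=
  (forall u v, nabla u v - nabla v u = br u v) /\
  (forall u v w, g (nabla u v) w + g v (nabla u w) = 0).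

Definition curvature (R : realType) (n : nat)
    (br nabla : 'rV[R]_n -> 'rV[R]_n -> 'rV[R]_n) (u v w : 'rV[R]_n) :
    'rV[R]_n :=
  nabla u (nabla v w) - nabla v (nabla u w) - nabla (br u v) w.

(* Trace of w |-> R(w, u) v; with the sign of [curvature] above, round spheres
   have positive Ricci curvature. *)
Definition ricci_form (R : realType) (n : nat)
    (br nabla : 'rV[R]_n -> 'rV[R]_n -> 'rV[R]_n) (u v : 'rV[R]_n) : R :=
  \tr (lin1_mx (fun w => curvature br nabla w u v)).

Definition is_ricci_operator (R : realType) (n : nat)
    (br : 'rV[R]_n -> 'rV[R]_n -> 'rV[R]_n) (g : {dot 'rV[R]_n for idfun})
    (Ric : 'rV[R]_n -> 'rV[R]_n) : Prop :=
  exists2 nabla : {bilinear 'rV[R]_n -> 'rV[R]_n -> 'rV[R]_n},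
    is_levi_civita br g nabla
    & forall u v, g (Ric u) v = ricci_form br nabla u v.

Definition is_derivation (R : realType) (n : nat)
    (br : 'rV[R]_n -> 'rV[R]_n -> 'rV[R]_n)
    (D : {linear 'rV[R]_n -> 'rV[R]_n}) : Prop :=
  forall u v, D (br u v) = br (D u) v + br u (D v).

(* The Ricci soliton condition for a left-invariant metric on a simply connected
   nilpotent Lie group, in its algebraic form Ric = c I + D. *)
Definition nilsoliton (R : realType) (n : nat)
    (br : 'rV[R]_n -> 'rV[R]_n -> 'rV[R]_n) (g : {dot 'rV[R]_n for idfun}) :
    Prop :=
  exists (c : R) (D : {linear 'rV[R]_n -> 'rV[R]_n}),
    is_derivation br D /\ is_ricci_operator br g (fun u => c *: u + D u).

Definition admits_nilsoliton (R : realType) (n : nat)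
    (br : 'rV[R]_n -> 'rV[R]_n -> 'rV[R]_n) : Prop :=
  exists g : {dot 'rV[R]_n for idfun}, nilsoliton br g.

(* The algebra of type (2, m) on n = n_1 (+) n_2, with n_1 = 'rV_m (the first
   summand), n_2 = 'rV_2, the X_i and Z_l being the standard basis vectors.
   [J Z] is the matrix of J_mu(Z) in the basis (X_i), whose columns are the
   images of the basis vectors; hence the transpose on row vectors in
     <mu(X, Y), Z_l> = <J_mu(Z_l) X, Y>.                                      *)
Definition mu_of (R : realType) (m : nat) (J : 'rV[R]_2 -> 'M[R]_m)
    (X Y : 'rV[R]_m) : 'rV[R]_2 :=
  \row_l (X *m (J (delta_mx 0 l))^T *m Y^T) 0 0.

Definition two_step_bracket (R : realType) (m : nat)
    (mu : 'rV[R]_m -> 'rV[R]_m -> 'rV[R]_2) (u v : 'rV[R]_(m + 2)) :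
    'rV[R]_(m + 2) :=
  row_mx 0 (mu (lsubmx u) (lsubmx v)).

Definition mx22 (R : realType) (p q s t : R) : 'M[R]_2 :=
  \matrix_(i, j) if i == 0 then (if j == 0 then p else q)
                 else (if j == 0 then s else t).

(* The blocks A_ij are indexed from 0 here, so i + j = k + 1 and i + j = k + 2
   become i + j = k - 1 and i + j = k. *)
Definition A_block (R : realType) (a b x y : R) (k : nat) :
    'M[R]_(\sum_(i < k) 2) :=
  \mxblock_(i < k, j < k)
    (if ((i + j).+1 == k)%N then mx22 (- (b * x)) (y - a * x) (y - a * x) (b * x)
     else if (i + j == k)%N then mx22 0 x x 0
     else 0).

Definition J_block (R : realType) (alpha : R[i]) (k : nat) (z : 'rV[R]_2) :
    'M[R]_(\sum_(i < k) 2 + \sum_(i < k) 2) :=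
  let A := A_block (complex.Re alpha) (complex.Im alpha) (z 0 0) (z 0 1) k in
  block_mx 0 A (- A^T) 0.

Definition J_S (R : realType) (r : nat) (alpha : 'I_r -> R[i])
    (k : 'I_r -> nat) (z : 'rV[R]_2) :
    'M[R]_(\sum_(i < r) (\sum_(j < k i) 2 + \sum_(j < k i) 2)) :=
  \mxdiag_(i < r) J_block (alpha i) (k i) z.

Arguments J_S {R r} alpha k z.

Definition mu_S (R : realType) (r : nat) (alpha : 'I_r -> R[i])
    (k : 'I_r -> nat) :
    let n := (\sum_(i < r) (\sum_(j < k i) 2 + \sum_(j < k i) 2) + 2)%N in
    'rV[R]_n -> 'rV[R]_n -> 'rV[R]_n :=
  two_step_bracket (mu_of (J_S alpha k)).

Arguments mu_S {R r} alpha k.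

(* Main.v *)
(* In coordinates that are orthonormal and adapted to n_1 (+) n_2, the Ricci operator
   is (1/2) (J_1^2 + J_2^2) on n_1 and - (1/4) (tr J_k J_l) on n_2.

   For a nonsingular nilsoliton let D = Ric - c. Since D J(Z) + J(Z) D = b J(Z) on
   eigenvectors Z of D in n_2 (D meaning D restricted to n_1 on the left), b is the same for
   all of them, and D - b/2 on n_1 anticommutes with J_1 and J_2, hence is trace-orthogonal
   to itself and vanishes. So J_1^2 + J_2^2 = kappa, which makes J(W) J(Z)^-1 normal for
   all Z != 0 and W. In mu_S a block with k >= 2 contributes a nontrivial complex Jordan
   block to J(Z_1) J(Z_2)^-1, which is impossible for a matrix similar to a normal one.

   If all k_i = 1, the function \prod_i (t^2 + |s - alpha_i|^2) / t attains its minimum on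
   the upper half plane, and the equations of the critical point (s, t) are exactly what is
   needed for a diagonal rescaling of (tZ_2, Z_1 + sZ_2) to satisfy the soliton equation. *)
Require Import Defs.
From mathcomp Require Import all_boot all_order all_algebra.
From mathcomp Require Import reals.
From HB Require Import structures.
From mathcomp Require Import ring lra zify.
Set Implicit Arguments.
Unset Strict Implicit.
Unset Printing Implicit Defensive.
Import Order.TTheory GRing.Theory Num.Theory.
Local Open Scope ring_scope.

(** * Inner products and bilinear products in coordinates *)

Section Packing.
Variables (R : realType) (n : nat).

Lemma bilinear_of (f : 'rV[R]_n -> 'rV[R]_n -> 'rV[R]_n) :
    (forall v, linear (f^~ v)) -> (forall u, linear (f u)) ->
  exists g : {bilinear 'rV[R]_n -> 'rV[R]_n -> 'rV[R]_n},
    forall u v, g u v = f u v.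
Proof.
move=> fl fr.
pose fM := bilinear_isBilinear.Build R 'rV[R]_n 'rV[R]_n 'rV[R]_n *:%R *:%R f
  (fl, fr).
pose g : {bilinear 'rV[R]_n -> 'rV[R]_n -> 'rV[R]_n} := HB.pack f fM.
by exists g.
Qed.

Lemma dot_of_gram (G : 'M[R]_n) :
    G^T = G -> (forall u : 'rV[R]_n, u != 0 -> 0 < (u *m G *m u^T) 0 0) ->
  exists g : {dot 'rV[R]_n for idfun}, forall u v, g u v = (u *m G *m v^T) 0 0.
Proof.
move=> Gsym Gpos.
pose f (u v : 'rV[R]_n) := (u *m G *m v^T) 0 0.
have fl v : linear_for *%R (f^~ v).
  by move=> a u w; rewrite /f !mulmxDl -!scalemxAl !mxE.
have fr u : linear_for (idfun \; *%R) (f u).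
  by move=> a v w; rewrite /f linearP /= mulmxDr -scalemxAr !mxE.
have fS u v : f u v = (-1) ^+ false * idfun (f v u).
  by rewrite expr0 mul1r /= /f -(trmxK (u *m G *m v^T)) mxE !trmx_mul trmxK Gsym mulmxA.
pose fB := bilinear_isBilinear.Build R 'rV[R]_n 'rV[R]_n R *%R (idfun \; *%R) f
  (fl, fr).
pose fH := isHermitianSesquilinear.Build R 'rV[R]_n false idfun f fS.
pose fD := isDotProduct.Build R 'rV[R]_n f Gpos.
pose g : {dot 'rV[R]_n for idfun} := HB.pack f fB fH fD.
by exists g.
Qed.

(** The Gram matrix is taken in the standard basis. Together with [dot_of_gram] this lets metrics be
    treated as positive definite matrices. *)
Lemma dot_gram (g : {dot 'rV[R]_n for idfun}) :
  exists G : 'M[R]_n, [/\ G^T = G, forall u v, g u v = (u *m G *m v^T) 0 0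
    & forall u : 'rV[R]_n, u != 0 -> 0 < (u *m G *m u^T) 0 0].
Proof.
pose G : 'M[R]_n := \matrix_(i, j) g 'e_i 'e_j.
have gS u v : g u v = g v u.
  by rewrite (hermitian_subproof (s:=g)) expr0 mul1r.
have gE u v : g u v = (u *m G *m v^T) 0 0.
  rewrite {1}(row_sum_delta u) {1}(row_sum_delta v).
  rewrite linear_sumlz mxE.
  rewrite (eq_bigr (fun i => \sum_j u 0 i * (v 0 j * g 'e_i 'e_j))); last first.
    move=> i _; rewrite linearZl_LR /= linear_sumr /= mulr_sumr.
    by apply: eq_bigr => j _; rewrite linearZr_LR.
  rewrite exchange_big; apply: eq_bigr => j _ /=.
  rewrite !mxE mulr_suml; apply: eq_bigr => i _; rewrite !mxE; ring.
exists G; split=> //.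
- by apply/matrixP => i j; rewrite !mxE gS.
- by move=> u u0; rewrite -gE; exact: neq0_dnorm_gt0.
Qed.

End Packing.

(** * Invariance of the soliton condition under isometric isomorphism *)

Section Transfer.
Variables (R : realType) (n : nat).
Implicit Types (br nabla : 'rV[R]_n -> 'rV[R]_n -> 'rV[R]_n).

(** [lin1_mx] represents a function faithfully only if the function is linear. Vanishing torsion
    writes [br] through the bilinear [nabla], which settles the bracket term. *)
Lemma curvature_linear br (g : {dot 'rV[R]_n for idfun})
    (nabla : {bilinear 'rV[R]_n -> 'rV[R]_n -> 'rV[R]_n}) u v :
  is_levi_civita br g nabla -> linear (fun w => curvature br nabla w u v).
Proof.
move=> [tor _] a w w'; rewrite /curvature -!tor.
rewrite !linearPl !linearBl !linearPl !linearPr !linearDl !linearZl_LR.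
by apply/rowP => j; rewrite !mxE; ring.
Qed.

(** [F] is an isometric isomorphism from the second structure to the first, acting on row vectors.
    Connection, curvature and derivation are conjugated by it, and traces do not change. *)
Lemma nilsoliton_transfer br1 br2 (g1 g2 : {dot 'rV[R]_n for idfun})
    (F : 'M[R]_n) : F \in unitmx ->
    (forall u v, br2 u v = br1 (u *m F) (v *m F) *m invmx F) ->
    (forall u v, g2 u v = g1 (u *m F) (v *m F)) ->
  nilsoliton br1 g1 -> nilsoliton br2 g2.
Proof.
move=> uF brE gE [c [D [derD [nabla lc ricE]]]].
pose D2 : {linear 'rV[R]_n -> 'rV[R]_n} := mulmxr (invmx F) \o D \o mulmxr F.
have D2E u : D2 u = D (u *m F) *m invmx F by [].
exists c, D2; split.
  by move=> u v; rewrite !brE !D2E !mulmxKV // derD mulmxDl.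
have [nabla2 nabla2E] : exists nabla2 : {bilinear 'rV[R]_n -> 'rV[R]_n -> 'rV[R]_n},
    forall u v, nabla2 u v = nabla (u *m F) (v *m F) *m invmx F.
  apply: bilinear_of => [v a u w|u a v w].
    by rewrite mulmxDl -scalemxAl linearPl mulmxDl -scalemxAl.
  by rewrite mulmxDl -scalemxAl linearPr mulmxDl -scalemxAl.
exists nabla2; first split.
- by move=> u v; rewrite !nabla2E brE -mulmxBl lc.1.
- by move=> u v w; rewrite !gE !nabla2E !mulmxKV // lc.2.
move=> u v; rewrite gE D2E mulmxDl mulmxKV // -scalemxAl ricE /ricci_form.
pose h : {linear 'rV[R]_n -> 'rV[R]_n} :=
  HB.pack (fun w => curvature br1 nabla w (u *m F) (v *m F))
    (GRing.isLinear.Build _ _ _ _ _ (curvature_linear (u *m F) (v *m F) lc)).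
have -> : lin1_mx (fun w => curvature br2 nabla2 w u v)
        = F *m (lin1_mx h *m invmx F).
  apply/row_matrixP => i.
  rewrite !rowE (mulmxA _ F) !mulmxA mul_rV_lin1 /=.
  have -> : 'e_i *m lin1_mx (fun w => curvature br2 nabla2 w u v)
     = curvature br2 nabla2 'e_i u v.
    by rewrite -rowE; apply/rowP => j; rewrite !mxE.
  by rewrite /curvature !nabla2E !brE !mulmxKV // !mulmxBl.
by rewrite mxtrace_mulC -mulmxA mulVmx // mulmx1.
Qed.

End Transfer.

(** * Auxiliary identities for entries and traces *)

Lemma mx11_trC (R : realType) n (u v : 'rV[R]_n) : u *m v^T = v *m u^T.
Proof.
by rewrite -[LHS](trmxK) trmx_mul trmxK; apply/matrixP => i j; rewrite !ord1 mxE.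
Qed.

Section Entries.
Variables (R : realType) (m n : nat).
Implicit Types (A B : 'M[R]_(m, n)).

Lemma addmxE A B i j : (A + B) i j = A i j + B i j. Proof. exact: mxE. Qed.

Lemma oppmxE A i j : (- A) i j = - A i j. Proof. exact: mxE. Qed.

Lemma scalemxE a A i j : (a *: A) i j = a * A i j. Proof. exact: mxE. Qed.

Lemma zeromxE i j : (0 : 'M[R]_(m, n)) i j = 0. Proof. exact: mxE. Qed.

End Entries.

Lemma skew_mxtrace0 (R : realType) n (A : 'M[R]_n) : A^T = - A -> \tr A = 0.
Proof. by move=> skA; have := mxtrace_tr A; rewrite skA raddfN /=; lra. Qed.

Lemma rV_dotP (R : realType) n (u v : 'rV[R]_n) :
  (forall w : 'rV[R]_n, (u *m w^T) 0 0 = (v *m w^T) 0 0) -> u = v.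
Proof.
move=> h; apply/rowP => j; have := h 'e_j.
by rewrite !mxE (bigD1 j) //= [in RHS](bigD1 j) //= !big1 => [|i ij|i ij];
  rewrite !mxE ?eqxx ?mulr1 ?addr0 ?(negPf ij) ?andbF ?mulr0.
Qed.

(** A trace sees only diagonal blocks, so the off-diagonal components of the curvature never have to
    be computed. *)
Lemma mxtrace_lin1_row_mx (R : realType) m p
    (h : 'rV[R]_(m + p) -> 'rV[R]_(m + p)) (K : 'M[R]_m) (L : 'M[R]_p) :
    (forall A, lsubmx (h (row_mx A 0)) = A *m K) ->
    (forall C, rsubmx (h (row_mx 0 C)) = C *m L) ->
  \tr (lin1_mx h) = \tr K + \tr L.
Proof.
move=> hK hL; rewrite /mxtrace big_split_ord /=; congr (_ + _).
  apply: eq_bigr => i _; have := hK 'e_i; rewrite -delta_mx_lshift -rowE.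
  by move=> /rowP /(_ i); rewrite !mxE.
apply: eq_bigr => i _; have := hL 'e_i; rewrite -delta_mx_rshift -rowE.
by move=> /rowP /(_ i); rewrite !mxE.
Qed.

(** * Connection, Ricci form and soliton equation of a two-step algebra *)

(* In the orthonormal basis given by the coordinates, the matrix M l acts on row
   vectors as J(Z_l) does on n_1. *)
Section TwoStep.
Variables (R : realType) (m : nat) (M : 'I_2 -> 'M[R]_m).
Implicit Types (X Y A : 'rV[R]_m) (Z W C : 'rV[R]_2).

Definition bracket_mx X Y : 'rV[R]_2 := \row_l (X *m M l *m Y^T) 0 0.

(** This is J(Z), acting on row vectors from the right. *)
Definition pencil Z : 'M[R]_m := \sum_l Z 0 l *: M l.

Lemma bracket_mx_entry X Y l : bracket_mx X Y 0 l = (X *m M l *m Y^T) 0 0.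
Proof. exact: mxE. Qed.

Lemma bracket_mxE X Y W : bracket_mx X Y *m W^T = X *m pencil W *m Y^T.
Proof.
rewrite /pencil mulmx_sumr mulmx_suml; apply/matrixP => i j.
rewrite !ord1 summxE mxE; apply: eq_bigr => l _.
by rewrite -scalemxAr -scalemxAl [RHS]mxE mulrC !mxE.
Qed.

Lemma pencil_linear : linear pencil.
Proof.
move=> a Z W; rewrite /pencil scaler_sumr -big_split /=; apply: eq_bigr => l _.
by rewrite !mxE scalerDl scalerA.
Qed.

HB.instance Definition _ := GRing.isLinear.Build R _ _ _ pencil pencil_linear.

Lemma bracket_mx_linearl Y : linear (bracket_mx^~ Y).
Proof.
move=> a X X'; apply: rV_dotP => W.
by rewrite mulmxDl -scalemxAl !bracket_mxE !mulmxDl -!scalemxAl.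
Qed.

Lemma bracket_mx_linearr X : linear (bracket_mx X).
Proof.
move=> a Y Y'; apply: rV_dotP => W.
by rewrite mulmxDl -scalemxAl !bracket_mxE linearP /= mulmxDr -scalemxAr.
Qed.

(** Exhibits a curvature term as [A] times a fixed matrix, so that its trace in [A] can be read off.
    The scalar inside J is absorbed into a rank-one product. *)
Lemma pencil_bracket_mx X Y A :
  X *m pencil (bracket_mx A Y) = A *m \sum_l (M l *m Y^T *m X *m M l).
Proof.
rewrite /pencil !mulmx_sumr. apply: eq_bigr => l _.
by rewrite mxE -scalemxAr -mul_scalar_mx -mx11_scalar !mulmxA.
Qed.

Lemma pencil_delta l : pencil 'e_l = M l.
Proof.
rewrite /pencil (bigD1 l) //= mxE !eqxx scale1r big1 ?addr0 // => k kl.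
by rewrite mxE (negPf kl) andbF scale0r.
Qed.

Hypothesis skM : forall l, (M l)^T = - M l.

Lemma pencil_skew Z : (pencil Z)^T = - pencil Z.
Proof.
rewrite /pencil linear_sum -sumrN; apply: eq_bigr => l _.
by rewrite linearZ /= skM scalerN.
Qed.

Lemma bracket_mxC X Y : bracket_mx Y X = - bracket_mx X Y.
Proof.
apply: rV_dotP => W; rewrite mulNmx !bracket_mxE mx11_trC trmx_mul pencil_skew.
by rewrite mulNmx mulmxN mulmxA.
Qed.

(** For X, Y in n_1 and Z, Z' in n_2 this says nabla_X Y = [X, Y]/2, nabla_X Z = nabla_Z X = -
    J(Z)X/2 and nabla_Z Z' = 0. *)
Definition nabla_mx (u v : 'rV[R]_(m + 2)) : 'rV[R]_(m + 2) :=
  row_mx (- 2^-1 *: (lsubmx u *m pencil (rsubmx v) + lsubmx v *m pencil (rsubmx u)))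
         (2^-1 *: bracket_mx (lsubmx u) (lsubmx v)).

Lemma nabla_mx_linearl v : linear (nabla_mx^~ v).
Proof.
move=> a u w; rewrite /nabla_mx scale_row_mx add_row_mx.
rewrite !(linearP (@lsubmx _ _ _ _)) !(linearP (@rsubmx _ _ _ _)) /=.
rewrite (linearP pencil) bracket_mx_linearl !mulmxDl !mulmxDr -!scalemxAl -!scalemxAr.
by congr row_mx; apply/rowP => j; rewrite !mxE; ring.
Qed.

Lemma nabla_mx_linearr u : linear (nabla_mx u).
Proof.
move=> a v w; rewrite /nabla_mx scale_row_mx add_row_mx.
rewrite !(linearP (@lsubmx _ _ _ _)) !(linearP (@rsubmx _ _ _ _)) /=.
rewrite (linearP pencil) bracket_mx_linearr !mulmxDl !mulmxDr -!scalemxAl -!scalemxAr.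
by congr row_mx; apply/rowP => j; rewrite !mxE; ring.
Qed.

Let br := two_step_bracket bracket_mx.

Section Standard.
Variable g : {dot 'rV[R]_(m + 2) for idfun}.
Hypothesis gE : forall u v, g u v = (u *m v^T) 0 0.

Lemma dot_sub u v :
  g u v = (lsubmx u *m (lsubmx v)^T) 0 0 + (rsubmx u *m (rsubmx v)^T) 0 0.
Proof. by rewrite gE -[in LHS](hsubmxK u) -[in LHS](hsubmxK v) tr_row_mx mul_row_col mxE. Qed.

Lemma dotC u v : g u v = g v u.
Proof. by rewrite !gE mx11_trC. Qed.

(** Combines metric compatibility for the three cyclic arrangements with vanishing torsion. The
    derivative terms of the usual Koszul formula are absent for left-invariant fields. *)
Lemma koszul (nabla : {bilinear 'rV[R]_(m + 2) -> 'rV[R]_(m + 2) -> 'rV[R]_(m + 2)}) :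
  is_levi_civita br g nabla -> forall u v w,
  g (nabla u v) w = 2^-1 * (g (br u v) w - g (br v w) u + g (br w u) v).
Proof.
move=> [tor met] u v w; rewrite -!tor !linearBl /=.
have := met u v w; have := met v u w; have := met w u v.
rewrite (dotC (nabla w u)) (dotC v (nabla u w)) (dotC u (nabla v w)).
rewrite (dotC u (nabla w v)) (dotC v (nabla w u)); lra.
Qed.

Lemma nabla_mxP (u v w : 'rV[R]_(m + 2)) :
  g (nabla_mx u v) w = 2^-1 * (g (br u v) w - g (br v w) u + g (br w u) v).
Proof.
rewrite !dot_sub /br /two_step_bracket /nabla_mx !row_mxKl !row_mxKr.
rewrite -!scalemxAl !mul0mx !bracket_mxE.
have E (A B : 'rV[R]_m) Z : (A *m pencil Z *m B^T) 0 0 = - (B *m pencil Z *m A^T) 0 0.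
  by rewrite mx11_trC trmx_mul pencil_skew mulNmx mulmxN mulmxA oppmxE.
rewrite mulmxDl !(addmxE, scalemxE).
rewrite (E (lsubmx w) (lsubmx u)) !zeromxE; lra.
Qed.

(** Uniqueness holds because both products satisfy the Koszul identity against every [w]. Conversely
    that identity, with a skew bracket, yields vanishing torsion and metric compatibility. *)
Lemma levi_civita_nabla_mx
    (nabla : {bilinear 'rV[R]_(m + 2) -> 'rV[R]_(m + 2) -> 'rV[R]_(m + 2)}) :
  is_levi_civita br g nabla <-> forall u v, nabla u v = nabla_mx u v.
Proof.
split=> [lc u v|nE].
  by apply: rV_dotP => w; rewrite -!gE (koszul lc) nabla_mxP.
have brC u v : br u v = - br v u.
  by rewrite /br /two_step_bracket bracket_mxC opp_row_mx oppr0.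
split=> [u v|u v w].
  apply: rV_dotP => w; rewrite -!gE linearBl /= !nE !nabla_mxP.
  rewrite (brC v u) (brC u w) (brC w v) !linearNl /=; lra.
rewrite (dotC v) !nE !nabla_mxP.
rewrite (brC v u) (brC u w) (brC w v) !linearNl /=; lra.
Qed.

Definition sqsum_mx : 'M[R]_m := \sum_l (M l *m M l).

Definition trace_mx : 'M[R]_2 := \matrix_(k, l) \tr (M k *m M l).

Lemma trace_mxE Z W : (Z *m trace_mx *m W^T) 0 0 = \tr (pencil Z *m pencil W).
Proof.
rewrite /pencil mulmx_sumr raddf_sum mxE /=; apply: eq_bigr => l _.
rewrite mulmx_suml raddf_sum !mxE mulr_suml /=; apply: eq_bigr => k _.
by rewrite -scalemxAl -scalemxAr !mxtraceZ !mxE; ring.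
Qed.

Lemma sqsum_mx_sym : sqsum_mx^T = sqsum_mx.
Proof.
rewrite /sqsum_mx linear_sum; apply: eq_bigr => l _.
by rewrite /= trmx_mul skM mulmxN mulNmx opprK.
Qed.

(** The trace of w -> R(w, u)v is the sum of its n_1 block [K] and its n_2 block [- 4^-1 *: L]. The
    coefficient of [sqsum_mx] arises as 1/4 + 1/2 - 1/4, and the first term of [K] is skew, hence
    traceless. *)
Lemma ricci_form_nabla_mx (u v : 'rV[R]_(m + 2)) :
  ricci_form br nabla_mx u v =
  2^-1 * (lsubmx u *m sqsum_mx *m (lsubmx v)^T) 0 0
  - 4^-1 * \tr (pencil (rsubmx u) *m pencil (rsubmx v)).
Proof.
rewrite -[u]hsubmxK -[v]hsubmxK !row_mxKl !row_mxKr.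
move: (lsubmx u) (rsubmx u) (lsubmx v) (rsubmx v) => X Z Y W.
pose K := - 4^-1 *: pencil (bracket_mx X Y)
  + 4^-1 *: (\sum_l (M l *m Y^T *m X *m M l)) - 4^-1 *: (pencil W *m pencil Z)
  + 2^-1 *: (\sum_l (M l *m X^T *m Y *m M l)).
pose L : 'M[R]_2 := \matrix_(c, l) (X *m M l *m M c *m Y^T) 0 0.
have nablaE X1 Z1 X2 Z2 : nabla_mx (row_mx X1 Z1) (row_mx X2 Z2) =
    row_mx (- 2^-1 *: (X1 *m pencil Z2 + X2 *m pencil Z1)) (2^-1 *: bracket_mx X1 X2).
  by rewrite /nabla_mx !row_mxKl !row_mxKr.
have brE X1 Z1 X2 Z2 : br (row_mx X1 Z1) (row_mx X2 Z2) = row_mx 0 (bracket_mx X1 X2).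
  by rewrite /br /two_step_bracket !row_mxKl.
have trP (A B : 'rV[R]_m) :
    \tr (\sum_l (M l *m A^T *m B *m M l)) = (B *m sqsum_mx *m A^T) 0 0.
  rewrite raddf_sum /sqsum_mx mulmx_sumr mulmx_suml summxE; apply: eq_bigr => l _ /=.
  by rewrite -mulmxA mxtrace_mulC !mulmxA /mxtrace big_ord1.
rewrite /ricci_form (@mxtrace_lin1_row_mx _ _ _ _ K (- 4^-1 *: L)).
- have trL : \tr L = (X *m sqsum_mx *m Y^T) 0 0.
    rewrite /sqsum_mx mulmx_sumr mulmx_suml summxE; apply: eq_bigr => l _.
    by rewrite [LHS]mxE !mulmxA.
  rewrite !mxtraceD raddfN /= !mxtraceZ trL !trP skew_mxtrace0 ?pencil_skew //.
  rewrite (mxtrace_mulC (pencil W)).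
  have -> : (Y *m sqsum_mx *m X^T) 0 0 = (X *m sqsum_mx *m Y^T) 0 0.
    by rewrite mx11_trC trmx_mul sqsum_mx_sym mulmxA.
  lra.
- move=> A; rewrite /curvature !(nablaE, brE) !(row_mxKl, row_mxKr).
  rewrite !opp_row_mx !add_row_mx row_mxKl.
  rewrite !mul0mx !linear0 ?mulmx0 !add0r !addr0.
  rewrite !(linearZ_LR pencil) /= /K -!scalemxAr !pencil_bracket_mx.
  rewrite !(mulmxDr, mulmxN) -!scalemxAl -!scalemxAr pencil_bracket_mx !mulmxA.
  apply/rowP => j; rewrite !(addmxE, scalemxE, oppmxE).
  lra.
- move=> C; rewrite /curvature !(nablaE, brE) !(row_mxKl, row_mxKr).
  rewrite !opp_row_mx !add_row_mx row_mxKr.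
  have b0 A : bracket_mx 0 A = 0.
    by apply: rV_dotP => V; rewrite bracket_mxE !mul0mx.
  have bZ a A : bracket_mx X (a *: A) = a *: bracket_mx X A.
    apply: rV_dotP => V.
    by rewrite -scalemxAl !bracket_mxE linearZ /= -scalemxAr.
  rewrite !b0 mul0mx add0r scaler0 subr0 sub0r bZ scalerA -scaleNr -scalemxAr.
  have -> : bracket_mx X (Y *m pencil C) = - (C *m L).
    apply/rowP => l; rewrite oppmxE bracket_mx_entry trmx_mul pencil_skew mulNmx mulmxN oppmxE.
    congr (- _); rewrite /pencil mulmx_suml mulmx_sumr summxE mxE.
    apply: eq_bigr => k _.
    by rewrite -scalemxAl -scalemxAr scalemxE [L _ _]mxE !mulmxA.
  by rewrite scalerN -scaleNr; congr (_ *: _); lra.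
Qed.

(** The metric determines Ric from the Ricci form, so D = Ric - c is forced and preserves n_1 and
    n_2, with restrictions [D1] and [D2]. As n_2 is central, the derivation property is tested on
    pairs from n_1, one coordinate [l] of the bracket at a time. *)
Lemma nilsoliton_stdP :
  nilsoliton br g <-> exists c : R,
    let D1 := 2^-1 *: sqsum_mx - c%:M in
    let D2 := - 4^-1 *: trace_mx - c%:M in
    forall l, \sum_k D2 k l *: M k = D1 *m M l + M l *m D1.
Proof.
have ricE (c : R) (u v : 'rV[R]_(m + 2)) :
    ricci_form br nabla_mx u v =
    g (c *: u + row_mx (lsubmx u *m (2^-1 *: sqsum_mx - c%:M))
                  (rsubmx u *m (- 4^-1 *: trace_mx - c%:M))) v.
  rewrite ricci_form_nabla_mx -[c *: u]hsubmxK add_row_mx dot_sub row_mxKl row_mxKr.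
  rewrite !linearZ /= !mulmxBr !mul_mx_scalar.
  rewrite !(addrC (c *: _)) !subrK -!scalemxAr -!scalemxAl !scalemxE trace_mxE; lra.
have derE (D : 'rV[R]_(m + 2) -> 'rV[R]_(m + 2)) (D1 : 'M[R]_m) (D2 : 'M[R]_2) :
    D1^T = D1 -> (forall u, D u = row_mx (lsubmx u *m D1) (rsubmx u *m D2)) ->
    (forall u v, D (br u v) = br (D u) v + br u (D v)) <->
    (forall l, \sum_k D2 k l *: M k = D1 *m M l + M l *m D1).
  move=> D1s DE.
  have bE (X Y : 'rV[R]_m) l : (bracket_mx X Y *m D2) 0 l
      = (X *m (\sum_k D2 k l *: M k) *m Y^T) 0 0.
    rewrite mulmx_sumr mulmx_suml summxE mxE; apply: eq_bigr => k _.
    by rewrite -scalemxAr -scalemxAl scalemxE bracket_mx_entry mulrC.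
  have dE (X Y : 'rV[R]_m) l :
      (bracket_mx (X *m D1) Y + bracket_mx X (Y *m D1)) 0 l
      = (X *m (D1 *m M l + M l *m D1) *m Y^T) 0 0.
    by rewrite addmxE !bracket_mx_entry trmx_mul D1s mulmxDr mulmxDl !mulmxA addmxE.
  split=> [derD l|h u v].
    apply/row_matrixP => i; rewrite !rowE; apply: rV_dotP => Y.
    have := derD (row_mx 'e_i 0) (row_mx Y 0).
    rewrite !DE /br /two_step_bracket !row_mxKl !row_mxKr mul0mx add_row_mx addr0.
    by move=> /eq_row_mx [_ /rowP /(_ l)]; rewrite bE dE.
  rewrite !DE /br /two_step_bracket !row_mxKl !row_mxKr mul0mx add_row_mx addr0.
  by congr row_mx; apply/rowP => l; rewrite bE h dE.
have D1s (c : R) : (2^-1 *: sqsum_mx - c%:M)^T = 2^-1 *: sqsum_mx - c%:M.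
  by rewrite linearB linearZ /= tr_scalar_mx sqsum_mx_sym.
split=> [[c [D [derD [nabla lc ric]]]]|[c h]]; exists c.
  apply/(derE D) => // u; apply: rV_dotP => v.
  have := ric u v; have /levi_civita_nabla_mx nE := lc.
  have -> : ricci_form br nabla u v = ricci_form br nabla_mx u v.
    by rewrite /ricci_form; congr (\tr _); apply/matrixP => i j;
      rewrite [LHS]mxE [RHS]mxE /curvature !nE.
  by rewrite (ricE c) !linearDl /= => /addrI; rewrite !gE.
pose D : {linear 'rV[R]_(m + 2) -> 'rV[R]_(m + 2)} :=
  mulmxr (block_mx (2^-1 *: sqsum_mx - c%:M) 0 0 (- 4^-1 *: trace_mx - c%:M)).
have DE u : D u = row_mx (lsubmx u *m (2^-1 *: sqsum_mx - c%:M))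
                  (rsubmx u *m (- 4^-1 *: trace_mx - c%:M)).
  by rewrite /D /= -{1}[u]hsubmxK mul_row_block !mulmx0 addr0 add0r.
exists D; split; first exact/(derE D _ _ (D1s c) DE).
have [nabla nE] := bilinear_of nabla_mx_linearl nabla_mx_linearr.
exists nabla; first exact/levi_civita_nabla_mx.
move=> u v; rewrite DE -ricE /ricci_form; congr (\tr _); apply/matrixP => i j.
by rewrite [LHS]mxE [RHS]mxE /curvature !nE.
Qed.

End Standard.
End TwoStep.

(** * Positive definite matrices and adapted orthonormal bases *)

Lemma ker0_unitmx (F : fieldType) n (A : 'M[F]_n) :
  (forall u : 'rV_n, u *m A = 0 -> u = 0) -> A \in unitmx.
Proof. by move=> h; rewrite -row_free_unit; apply: inj_row_free. Qed.

Lemma rV_sqnorm_eq0 (R : realType) n (u : 'rV[R]_n) : u *m u^T = 0 -> u = 0.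
Proof.
move=> /matrixP /(_ 0 0); rewrite !mxE => /eqP.
rewrite psumr_eq0 => [/allP h|i _]; last by rewrite mxE -expr2 sqr_ge0.
apply/rowP => i; have := h i (mem_index_enum _).
by rewrite mxE mulf_eq0 orbb mxE => /eqP.
Qed.

Section Posdef.
Variable R : realType.

Definition posdef n (G : 'M[R]_n) :=
  G^T = G /\ forall u : 'rV[R]_n, u != 0 -> 0 < (u *m G *m u^T) 0 0.

Lemma posdef_unitmx n (G : 'M[R]_n) : posdef G -> G \in unitmx.
Proof.
move=> [_ pG]; apply: ker0_unitmx => u uG; apply/eqP; apply: contraT => /pG.
by rewrite uG mul0mx mxE ltxx.
Qed.

Lemma posdef_congr n (G E : 'M[R]_n) :
  E \in unitmx -> posdef G -> posdef (E *m G *m E^T).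
Proof.
move=> uE [sG pG]; split; first by rewrite !trmx_mul trmxK sG mulmxA.
move=> u u0; have := pG (u *m E); rewrite trmx_mul !mulmxA; apply.
by apply: contraNneq u0 => uE0; rewrite -(mulmxK uE u) uE0 mul0mx.
Qed.

Lemma posdef_1mx n : posdef (1%:M : 'M[R]_n).
Proof.
split=> [|u u0]; first by rewrite tr_scalar_mx.
rewrite mulmx1 lt_def; apply/andP; split; last first.
  by rewrite mxE sumr_ge0 // => i _; rewrite mxE -expr2 sqr_ge0.
apply: contraNneq u0 => h; apply/eqP/rV_sqnorm_eq0.
by rewrite [_ *m _]mx11_scalar h; apply/matrixP => i j; rewrite !mxE mul0rn.
Qed.

Lemma posdef_block_diag m p (A : 'M[R]_m) (D : 'M[R]_p) :
  posdef (block_mx A 0 0 D) -> posdef A /\ posdef D.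
Proof.
move=> [s pG]; move: s; rewrite tr_block_mx => /eq_block_mx [sA _ _ sD].
split; split=> // u u0.
  have := pG (row_mx u 0); rewrite mul_row_block !(mulmx0, mul0mx, addr0, add0r).
  rewrite tr_row_mx mul_row_col trmx0 !(mulmx0, mul0mx, addr0, add0r); apply.
  by apply: contraNneq u0; rewrite -row_mx0 => /eq_row_mx[->].
have := pG (row_mx 0 u); rewrite mul_row_block !(mulmx0, mul0mx, addr0, add0r).
rewrite tr_row_mx mul_row_col trmx0 !(mulmx0, mul0mx, addr0, add0r); apply.
by apply: contraNneq u0; rewrite -row_mx0 => /eq_row_mx[_ ->].
Qed.

Lemma ublock_unitmx m p (P : 'M[R]_m) (Q : 'M[R]_(m, p)) (T : 'M[R]_p) :
  P \in unitmx -> T \in unitmx -> block_mx P Q 0 T \in unitmx.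
Proof. by rewrite !unitmxE det_ublock unitrM => -> ->. Qed.

Lemma posdef_drsubmx m p (G : 'M[R]_(m + p)) : posdef G -> posdef (drsubmx G).
Proof.
move=> [sG pG]; split; first by rewrite trmx_drsub sG.
move=> u u0; have := pG (row_mx 0 u).
rewrite -{1}[G]submxK mul_row_block tr_row_mx mul_row_col trmx0.
rewrite !(mulmx0, mul0mx, addr0, add0r); apply.
by apply: contraNneq u0; rewrite -row_mx0 => /eq_row_mx[_ ->].
Qed.

(** Block Gaussian elimination: each vector of the first summand is replaced by its component
    orthogonal to the second summand, which itself stays fixed. *)
Lemma posdef_eliminate m p (G : 'M[R]_(m + p)) : posdef G ->
  exists Q A D, [/\ posdef A, posdef D &
    block_mx 1%:M Q 0 1%:M *m G *m (block_mx 1%:M Q 0 1%:M)^T = block_mx A 0 0 D].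
Proof.
move=> pG; have pD := posdef_drsubmx pG; have uD := posdef_unitmx pD.
(* Chosen to make the upper right block vanish; the lower left one then vanishes by symmetry. *)
pose Q := - (ursubmx G *m invmx (drsubmx G)).
have E : block_mx 1%:M Q 0 1%:M *m G *m (block_mx 1%:M Q 0 1%:M)^T
    = block_mx (ulsubmx G + Q *m dlsubmx G) 0 0 (drsubmx G).
  rewrite -{1}[G]submxK tr_block_mx !mulmx_block !trmx1 !trmx0.
  rewrite !(mul1mx, mulmx1, mul0mx, mulmx0, addr0, add0r).
  have -> : ursubmx G + Q *m drsubmx G = 0 by rewrite /Q mulNmx mulmxKV // subrr.
  have -> : dlsubmx G + drsubmx G *m Q^T = 0.
    have sG := pG.1; have sD := pD.1.
    rewrite /Q linearN /= trmx_mul trmx_inv sD mulmxN mulKVmx //.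
    by rewrite trmx_ursub sG subrr.
  by rewrite mul0mx addr0.
have := posdef_congr (ublock_unitmx Q (unitmx1 _ _) (unitmx1 _ _)) pG.
by rewrite E => /posdef_block_diag[pA _]; exists Q, (ulsubmx G + Q *m dlsubmx G), (drsubmx G).
Qed.

(** The zero lower left block means that the last [p] vectors of the orthonormal basis span the
    second summand. For n_1 (+) n_2 the new basis is thus compatible with the central summand even
    if the metric does not make the summands orthogonal. *)
Lemma posdef_block_basis m p (G : 'M[R]_(m + p)) :
    (forall A : 'M[R]_m, posdef A -> exists2 P, P \in unitmx & P *m A *m P^T = 1%:M) ->
    (forall D : 'M[R]_p, posdef D -> exists2 T, T \in unitmx & T *m D *m T^T = 1%:M) ->
  posdef G -> exists P Q T, [/\ P \in unitmx, T \in unitmx &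
    block_mx P Q 0 T *m G *m (block_mx P Q 0 T)^T = 1%:M].
Proof.
move=> hm hp /posdef_eliminate[Q [A [D [/hm[P uP PE] /hp[T uT TE] E]]]].
exists P, (P *m Q), T; split=> //.
have -> : block_mx P (P *m Q) 0 T = block_mx P 0 0 T *m block_mx 1%:M Q 0 1%:M.
  by rewrite mulmx_block !(mulmx1, mulmx0, mul0mx, addr0, add0r).
set E0 := block_mx 1%:M Q 0 1%:M in E *; set B := block_mx P 0 0 T.
have -> : B *m E0 *m G *m (B *m E0)^T = B *m (E0 *m G *m E0^T) *m B^T.
  by rewrite trmx_mul !mulmxA.
rewrite E tr_block_mx !mulmx_block !trmx0.
by rewrite !(mulmx0, mul0mx, addr0, add0r) PE TE -scalar_mx_block.
Qed.

Lemma posdef_basis n (G : 'M[R]_n) :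
  posdef G -> exists2 P, P \in unitmx & P *m G *m P^T = 1%:M.
Proof.
elim: n G => [|n IHn]; last rewrite -[n.+1]/(1 + n)%N; move=> G pG.
  by exists 1%:M; [exact: unitmx1 | rewrite flatmx0; apply/matrixP => -[]].
have IH1 (A : 'M[R]_1) : posdef A -> exists2 P, P \in unitmx & P *m A *m P^T = 1%:M.
  move=> [_ /(_ 1%:M)]; rewrite oner_neq0 mul1mx trmx1 mulmx1 => /(_ isT) A0.
  have [s s0 ->] : exists2 s : R, s != 0 & A = (s ^+ 2)%:M.
    exists (Num.sqrt (A 0 0)); first by rewrite gt_eqF // sqrtr_gt0.
    by rewrite sqr_sqrtr ?ltW // -mx11_scalar.
  exists (s^-1)%:M; first by rewrite unitmxE det_scalar1 unitfE invr_neq0.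
  by rewrite tr_scalar_mx -!scalar_mxM; congr (_%:M); field.
have [P [Q [T [uP uT E]]]] := posdef_block_basis IH1 IHn pG.
by exists (block_mx P Q 0 T); [exact: ublock_unitmx | exact: E].
Qed.

End Posdef.

(** * Real symmetric and normal matrices *)

Lemma ord2P (P : 'I_2 -> Prop) : P 0 -> P 1 -> forall i, P i.
Proof.
move=> P0 P1 i; case: (unliftP 0 i) => [j|] -> //.
by have -> : lift 0 j = 1 by rewrite (ord1 j); apply/val_inj.
Qed.

(** A symmetric matrix of size two has two real eigenvalues, given by the quadratic formula. If they
    coincide, the discriminant, a sum of squares, vanishes. *)
Lemma mx22_single_eigenvalue (R : realType) (D : 'M[R]_2) (b : R) : D^T = D ->
    (forall (z : 'rV[R]_2) a, z != 0 -> z *m D = a *: z -> a = b) ->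
  D = b%:M.
Proof.
move=> sD h; set p := D 0 0; set q := D 0 1; set s := D 1 1.
have D10 : D 1 0 = q by rewrite -sD mxE.
have eig (x y a : R) : (x != 0) || (y != 0) ->
    x * p + y * q = a * x -> x * q + y * s = a * y -> a = b.
  move=> xy e0 e1; pose z : 'rV[R]_2 := \row_i (if i == 0 then x else y).
  apply: (h z).
    by apply: contraTneq xy => /rowP z0; have := z0 0; have := z0 1;
      rewrite !mxE /= => -> ->; rewrite eqxx.
  have zD i : (z *m D) 0 i = x * D 0 i + y * D 1 i.
    rewrite !mxE big_ord_recl big_ord1 !mxE /=.
    by have -> : lift ord0 ord0 = 1 :> 'I_2 by apply/val_inj.
  by apply/rowP; apply: ord2P; rewrite zD scalemxE mxE ?D10.
have [q0|q0] := eqVneq q 0.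
  have pb : p = b by apply: (eig 1 0); rewrite ?oner_neq0 // q0; ring.
  have sb : s = b by apply: (eig 0 1); rewrite ?oner_neq0 ?orbT // q0; ring.
  apply/matrixP; apply: ord2P; apply: ord2P; rewrite [RHS]mxE.
  - exact: pb.
  - exact: q0.
  - by rewrite D10 q0.
  - exact: sb.
(* The eigenvectors used next are (q, (s - p + dl)/2) and (q, (s - p - dl)/2), nonzero since [q]
   is. *)
pose dl := Num.sqrt ((p - s) ^+ 2 + 4 * q ^+ 2).
have d2 : dl ^+ 2 = (p - s) ^+ 2 + 4 * q ^+ 2.
  by rewrite sqr_sqrtr // addr_ge0 ?sqr_ge0 // mulr_ge0 ?sqr_ge0 ?ler0n.
have e1 : (p + s + dl) / 2 = b.
  by apply: (eig q ((s - p + dl) / 2)); rewrite ?q0 //; [field|nra].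
have e2 : (p + s - dl) / 2 = b.
  by apply: (eig q ((s - p - dl) / 2)); rewrite ?q0 //; [field|nra].
have d0 : dl = 0 by lra.
move: d2; rewrite d0 expr0n /= => /eqP.
rewrite eq_sym paddr_eq0 ?sqr_ge0 ?(mulr_ge0 _ (sqr_ge0 _)) ?ler0n // => /andP[_].
by rewrite mulf_eq0 sqrf_eq0 (negPf q0) pnatr_eq0.
Qed.

Lemma mxtrace_sqr_sym_eq0 (R : realType) n (S : 'M[R]_n) :
  S^T = S -> \tr (S *m S) = 0 -> S = 0.
Proof.
move=> sS; rewrite -{2}sS => t0; apply/row_matrixP => i; rewrite row0.
apply: rV_sqnorm_eq0; apply/matrixP => j k; rewrite !ord1 {j k}.
have -> : (row i S *m (row i S)^T) 0 0 = (S *m S^T) i i.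
  by rewrite !mxE; apply: eq_bigr => j _; rewrite !mxE.
have ge0 l : 0 <= (S *m S^T) l l.
  by rewrite mxE sumr_ge0 // => j _; rewrite mxE -expr2 sqr_ge0.
move: t0 => /eqP; rewrite /mxtrace psumr_eq0 // => /allP /(_ i).
by rewrite mem_index_enum zeromxE => /(_ isT) /eqP.
Qed.

(** A normal matrix and its transpose have the same kernel, so applying [T] twice kills nothing more
    than applying it once. *)
Lemma normal_ker (R : realType) n (T : 'M[R]_n) (u : 'rV[R]_n) :
  T *m T^T = T^T *m T -> u *m T *m T = 0 -> u *m T = 0.
Proof.
move=> nT uTT.
have uTTt : u *m T *m T^T = 0.
  apply: rV_sqnorm_eq0.
  by rewrite trmx_mul trmxK !mulmxA -(mulmxA (u *m T)) -nT !mulmxA uTT !mul0mx.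
by apply: rV_sqnorm_eq0; rewrite trmx_mul mulmxA uTTt mul0mx.
Qed.

(** * Algebraic consequences of the soliton equation *)

Section Soliton.
Variables (R : realType) (m : nat) (M : 'I_2 -> 'M[R]_m).
Hypothesis skM : forall l, (M l)^T = - M l.
Hypothesis ndM : forall Z, Z != 0 -> pencil M Z \in unitmx.

Lemma trace_mx_sym : (trace_mx M)^T = trace_mx M.
Proof. by apply/matrixP => i j; rewrite !mxE mxtrace_mulC. Qed.

(* On an eigenvector Z of D2 with eigenvalue a, multiplying by J(Z)^-1 and taking
   traces gives m a = 2 tr D1, so D2 is scalar; then D1 - a/2 anticommutes with
   each M l and is traceless, hence orthogonal to sqsum_mx and to itself. *)
Lemma nilsoliton_sqsum_scalar (c : R) :
    (forall l, \sum_k (- 4^-1 *: trace_mx M - c%:M) k l *: M k =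
       (2^-1 *: sqsum_mx M - c%:M) *m M l + M l *m (2^-1 *: sqsum_mx M - c%:M)) ->
  exists kappa, sqsum_mx M = kappa%:M.
Proof.
set D2 := _ - c%:M; set D1 := _ - c%:M => h.
(* The trace argument divides by [m]; in dimension zero every matrix is scalar. *)
have [m0|m0] := eqVneq m 0%N.
  by exists 0; apply/matrixP => i; have := leq_ltn_trans (leq0n i) (ltn_ord i);
      rewrite lt0n => /eqP.
have sD2 : D2^T = D2 by rewrite linearB linearZ /= trace_mx_sym tr_scalar_mx.
have mR0 : m%:R != 0 :> R by rewrite pnatr_eq0.
have hZ Z : pencil M (Z *m D2) = D1 *m pencil M Z + pencil M Z *m D1.
  rewrite /pencil !mulmx_sumr !mulmx_suml -big_split /=.
  under [RHS]eq_bigr => l _ do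
    rewrite -scalemxAr -scalemxAl -scalerDr -h scaler_sumr.
  rewrite exchange_big; apply: eq_bigr => k _ /=.
  rewrite mxE scaler_suml; apply: eq_bigr => l _.
  by rewrite -[in LHS]sD2 mxE scalerA.
pose b := 2 * \tr D1 / m%:R.
have D2E : D2 = b%:M.
  apply: mx22_single_eigenvalue => // Z a Z0 Za.
  have := hZ Z; rewrite Za linearZ /= => e.
  have : \tr (a *: pencil M Z *m invmx (pencil M Z)) =
         \tr ((D1 *m pencil M Z + pencil M Z *m D1) *m invmx (pencil M Z)).
    by rewrite e.
  rewrite -scalemxAl mulmxV ?ndM // mxtraceZ mxtrace1 mulmxDl mulmxK ?ndM //.
  rewrite mxtraceD (mxtrace_mulC (_ *m D1)) mulmxA mulVmx ?ndM // mul1mx.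
  by rewrite /b => e2; apply: (mulIf mR0); rewrite e2; field.
pose S := D1 - (b / 2)%:M.
have SM l : S *m M l = - (M l *m S).
  rewrite /S mulmxBl mulmxBr mul_scalar_mx mul_mx_scalar.
  have := h l; rewrite D2E (bigD1 l) //= mxE eqxx mulr1n big1 ?addr0 => [e|k kl].
    have {}e : D1 *m M l = b *: M l - M l *m D1 by rewrite e addrK.
    rewrite e opprB addrAC; congr (_ - _); rewrite -scalerBl; congr (_ *: _); lra.
  by rewrite ?mxE (negPf kl) mulr0n scale0r.
have trS0 : \tr S = 0.
  have u0 : M 0 \in unitmx.
    rewrite -pencil_delta ndM //; apply/eqP => /rowP /(_ 0).
    by rewrite !mxE => /eqP; rewrite oner_eq0.
  have : \tr (S *m M 0 *m invmx (M 0)) = - \tr (M 0 *m S *m invmx (M 0)).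
    by rewrite SM mulNmx raddfN.
  by rewrite mulmxK // (mxtrace_mulC (_ *m S)) mulmxA mulVmx // mul1mx; lra.
have trSM l : \tr (S *m (M l *m M l)) = 0.
  have : \tr (S *m M l *m M l) = - \tr (M l *m S *m M l).
    by rewrite SM mulNmx raddfN.
  rewrite (mxtrace_mulC (_ *m S)) (mulmxA _ _ S) (mxtrace_mulC _ S) -mulmxA; lra.
have sS : S^T = S.
  by rewrite /S /D1 !linearB /= linearZ /= !tr_scalar_mx sqsum_mx_sym.
have S0 : S = 0.
  apply: mxtrace_sqr_sym_eq0 => //.
  have SE : S = 2^-1 *: sqsum_mx M - (c + b / 2)%:M.
    by rewrite /S /D1 raddfD opprD addrA.
  rewrite {2}SE mulmxBr -scalemxAr mul_mx_scalar raddfB /= !mxtraceZ trS0.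
  rewrite /sqsum_mx mulmx_sumr raddf_sum /= big1 => [|l _]; last exact: trSM.
  by rewrite !mulr0 subr0.
exists (2 * (b / 2 + c)).
have : 2^-1 *: sqsum_mx M = (b / 2 + c)%:M.
  rewrite raddfD /=; apply/eqP; rewrite -subr_eq -/D1 -subr_eq0; exact/eqP.
move=> /(congr1 ( *:%R 2)); rewrite scalerA scale_scalar_mx => <-.
by rewrite divff ?scale1r // pnatr_eq0.
Qed.

Variable kappa : R.
Hypothesis sqM : sqsum_mx M = kappa%:M.

(** [W] is [Z] turned by a right angle. The sum of the squares of J over an orthonormal basis of n_2
    does not depend on that basis, and the length of [Z] contributes the factor. *)
Lemma pencil_sqr (Z W : 'rV[R]_2) : W = \row_i (if i == 0 then - Z 0 1 else Z 0 0) ->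
  pencil M Z *m pencil M Z + pencil M W *m pencil M W
    = ((Z 0 0 ^+ 2 + Z 0 1 ^+ 2) * kappa)%:M.
Proof.
move=> ->; rewrite -scale_scalar_mx -sqM /pencil /sqsum_mx !big_ord_recl !big_ord0.
have -> : lift ord0 ord0 = 1 :> 'I_2 by apply/val_inj.
rewrite !mxE /= !addr0 !mulmxDl !mulmxDr -!scalemxAl -!scalemxAr !scalerA.
by apply/matrixP => i j; rewrite !(addmxE, scalemxE); ring.
Qed.

End Soliton.

(* J^2 = kappa - K^2 commutes with K. *)
Lemma skew_pair_normal (R : realType) n (J K : 'M[R]_n) (kappa : R) :
    J^T = - J -> K^T = - K -> J \in unitmx -> J *m J + K *m K = kappa%:M ->
  let N := K *m invmx J in N *m N^T = N^T *m N.
Proof.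
move=> sJ sK uJ sq N.
have KK : K *m K = kappa%:M - J *m J by rewrite -sq addrC addKr.
have JJ : J *m J = kappa%:M - K *m K by rewrite -sq addrK.
have NT : N^T = invmx J *m K.
  have sJi : (invmx J)^T = - invmx J.
    have : (J *m invmx J)^T *m invmx J = invmx J by rewrite mulmxV // trmx1 mul1mx.
    by rewrite trmx_mul sJ mulmxN mulNmx mulmxK // => {2}<-; rewrite opprK.
  by rewrite /N trmx_mul sK sJi mulmxN mulNmx opprK.
have KJJ : K *m (J *m J) = J *m J *m K.
  by rewrite JJ mulmxBr mulmxBl mulmxA mul_mx_scalar mul_scalar_mx.
have KJi : K *m (invmx J *m invmx J) = invmx J *m invmx J *m K.
  have : invmx J *m invmx J *m (K *m (J *m J)) *m (invmx J *m invmx J)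
       = invmx J *m invmx J *m (J *m J *m K) *m (invmx J *m invmx J).
    by rewrite KJJ.
  rewrite !mulmxA !mulmxK // -(mulmxA _ (invmx J) J) mulVmx // mulmx1 mulVmx //.
  by rewrite mul1mx => <-.
have -> : N *m N^T = invmx J *m invmx J *m (K *m K).
  by rewrite NT /N -!mulmxA (mulmxA _ _ K) (mulmxA K) KJi !mulmxA.
have -> : N^T *m N = invmx J *m (K *m K) *m invmx J by rewrite NT /N !mulmxA.
(* Both products become kappa J^-2 - 1. *)
rewrite KK !(mulmxBr, mulmxBl) !mul_mx_scalar !mulmxA mulmxK //.
by rewrite -(mulmxA _ (invmx J) J) mulVmx // mulmx1 !mulVmx // -scalemxAl.
Qed.

(** * Normality excludes Jordan blocks *)

(** [T] is a real polynomial in the normal matrix [N]. As a polynomial in [Q] it is the real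
    quadratic with roots - a + ib and - a - ib. *)
Lemma normal_quadratic (R : realType) n (N Q : 'M[R]_n) (be ga a b : R) :
    N *m N^T = N^T *m N -> Q = be%:M + ga *: N ->
  let T := (Q + a%:M) *m (Q + a%:M) + (b ^+ 2)%:M in T *m T^T = T^T *m T.
Proof.
move=> nN -> /=; set P := _ + a%:M.
have nP : P *m P^T = P^T *m P.
  rewrite /P !linearD /= !tr_scalar_mx linearZ /=.
  rewrite !(mulmxDr, mulmxDl) -!(scalemxAl, scalemxAr) nN !mul_mx_scalar !mul_scalar_mx.
  by apply/matrixP => i j; rewrite !(addmxE, scalemxE); ring.
clearbody P; have PPPP : P *m P *m (P^T *m P^T) = P^T *m P^T *m (P *m P).
  rewrite -!mulmxA (mulmxA P P^T) nP -!mulmxA nP !mulmxA nP.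
  by rewrite -(mulmxA P^T P P^T) nP !mulmxA.
rewrite linearD /= trmx_mul tr_scalar_mx !(mulmxDr, mulmxDl) PPPP.
rewrite !mul_mx_scalar !mul_scalar_mx.
by apply/matrixP => i j; rewrite !(addmxE, scalemxE); ring.
Qed.

(** With f = f0 + i f1 and e = e0 + i e1 the hypotheses read f Q = (- a + ib) f and e Q = (- a + ib)
    e + f, a Jordan chain of length two. [T] kills [f1] and sends [e0] to a nonzero multiple of it,
    so T^2 kills [e0], and by normality so does [T]. *)
Lemma jordan_block_no_eigen (R : realType) n (Q : 'M[R]_n) (a b : R)
    (f0 f1 e0 e1 : 'rV[R]_n) : b != 0 ->
    let T := (Q + a%:M) *m (Q + a%:M) + (b ^+ 2)%:M in T *m T^T = T^T *m T ->
    f0 *m Q = - a *: f0 - b *: f1 -> f1 *m Q = b *: f0 - a *: f1 ->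
    e0 *m Q = - a *: e0 - b *: e1 + f0 -> e1 *m Q = b *: e0 - a *: e1 + f1 ->
  f1 = 0.
Proof.
move=> b0 T nT f0E f1E e0E e1E; set P := Q + a%:M in T nT.
have f0P : f0 *m P = - b *: f1.
  rewrite /P mulmxDr f0E mul_mx_scalar.
  by apply/rowP => i; rewrite !(addmxE, scalemxE, oppmxE); ring.
have f1P : f1 *m P = b *: f0.
  rewrite /P mulmxDr f1E mul_mx_scalar.
  by apply/rowP => i; rewrite !(addmxE, scalemxE, oppmxE); ring.
have e0P : e0 *m P = - b *: e1 + f0.
  rewrite /P mulmxDr e0E mul_mx_scalar.
  by apply/rowP => i; rewrite !(addmxE, scalemxE, oppmxE); ring.
have e1P : e1 *m P = b *: e0 + f1.
  rewrite /P mulmxDr e1E mul_mx_scalar.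
  by apply/rowP => i; rewrite !(addmxE, scalemxE, oppmxE); ring.
have f1T : f1 *m T = 0.
  rewrite /T mulmxDr mulmxA f1P -scalemxAl f0P mul_mx_scalar.
  by apply/rowP => i; rewrite !(addmxE, scalemxE, zeromxE); ring.
have e0T : e0 *m T = (- 2 * b) *: f1.
  rewrite /T mulmxDr mulmxA e0P mulmxDl -scalemxAl e1P f0P mul_mx_scalar.
  by apply/rowP => i; rewrite !(addmxE, scalemxE); ring.
have : e0 *m T = 0 by apply: normal_ker => //; rewrite e0T -scalemxAl f1T scaler0.
by rewrite e0T => /eqP; rewrite scaler_eq0 mulf_eq0 oppr_eq0 pnatr_eq0 (negPf b0) => /eqP.
Qed.

Section NoJordan.
Variables (R : realType) (m : nat) (M : 'I_2 -> 'M[R]_m).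
Hypothesis skM : forall l, (M l)^T = - M l.
Variable kappa : R.
Hypothesis sqM : sqsum_mx M = kappa%:M.

(** In the orthogonal basis [Z], [V] of n_2, J(W) J(Z)^-1 becomes a scalar plus a multiple of the
    normal matrix J(V) J(Z)^-1, so it admits no Jordan chain. *)
Lemma sqsum_scalar_no_jordan (Z W : 'rV[R]_2) (a b : R) (f0 f1 e0 e1 : 'rV[R]_m) :
    b != 0 -> Z != 0 -> pencil M Z \in unitmx ->
    f0 *m pencil M W = (- a *: f0 - b *: f1) *m pencil M Z ->
    f1 *m pencil M W = (b *: f0 - a *: f1) *m pencil M Z ->
    e0 *m pencil M W = (- a *: e0 - b *: e1 + f0) *m pencil M Z ->
    e1 *m pencil M W = (b *: e0 - a *: e1 + f1) *m pencil M Z ->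
  f1 = 0.
Proof.
move=> b0 Z0 uZ f0E f1E e0E e1E.
pose V : 'rV[R]_2 := \row_i (if i == 0 then - Z 0 1 else Z 0 0).
pose d := Z 0 0 ^+ 2 + Z 0 1 ^+ 2.
have d0 : d != 0.
  apply: contraNneq Z0 => /eqP; rewrite /d paddr_eq0 ?sqr_ge0 // !sqrf_eq0.
  move=> /andP[/eqP z0 /eqP z1]; apply/eqP/rowP; apply: ord2P; rewrite mxE //.
(* The coordinates of [W] along [Z] and [V], both of squared length [d]. *)
pose be := (W 0 0 * Z 0 0 + W 0 1 * Z 0 1) / d.
pose ga := (W 0 1 * Z 0 0 - W 0 0 * Z 0 1) / d.
have WE : W = be *: Z + ga *: V.
  by apply/rowP; apply: ord2P; rewrite addmxE !scalemxE [V _ _]mxE /= /be /ga /d;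
    field; rewrite -/d.
pose N := pencil M V *m invmx (pencil M Z).
have nN : N *m N^T = N^T *m N.
  apply: (@skew_pair_normal _ _ _ _ (d * kappa)); rewrite ?pencil_skew //.
  exact: pencil_sqr.
have QE : pencil M W *m invmx (pencil M Z) = be%:M + ga *: N.
  by rewrite WE linearP /= linearZ /= mulmxDl -!scalemxAl mulmxV // scalemx1.
have := @jordan_block_no_eigen _ _ _ a b f0 f1 e0 e1 b0 (normal_quadratic a b nN QE).
by apply; rewrite mulmxA ?f0E ?f1E ?e0E ?e1E mulmxK.
Qed.

End NoJordan.

(** * Change to a basis adapted to n_2 *)

Section Congruence.
Variables (R : realType) (m : nat) (M : 'I_2 -> 'M[R]_m).
Hypothesis skM : forall l, (M l)^T = - M l.
Variables (P : 'M[R]_m) (Q : 'M[R]_(m, 2)) (T : 'M[R]_2).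
Hypothesis (uP : P \in unitmx) (uT : T \in unitmx).

(** The structure matrices of the bracket in the basis given by the rows of [F]: arguments enter
    through [P], values are rewritten by the inverse of [T]. *)
Definition congr_mx (l : 'I_2) : 'M[R]_m :=
  \sum_k invmx T k l *: (P *m M k *m P^T).

Let F := block_mx P Q 0 T.

Lemma congr_mx_skew l : (congr_mx l)^T = - congr_mx l.
Proof.
rewrite /congr_mx linear_sum -sumrN; apply: eq_bigr => k _ /=.
by rewrite linearZ /= !trmx_mul trmxK skM mulNmx mulmxN scalerN mulmxA.
Qed.

(** The argument of J is dual to the values of the bracket; since these transform by the inverse of
    [T], it transforms by the transpose of [T]. *)
Lemma pencil_congr_mx Z : pencil congr_mx (Z *m T^T) = P *m pencil M Z *m P^T.
Proof.
rewrite /pencil /congr_mx.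
under eq_bigr => l _ do rewrite scaler_sumr.
rewrite exchange_big mulmx_sumr mulmx_suml; apply: eq_bigr => k _ /=.
under eq_bigr => l _ do rewrite scalerA.
rewrite -scaler_suml -scalemxAr -scalemxAl; congr (_ *: _).
transitivity ((Z *m T^T *m (invmx T)^T) 0 k).
  by rewrite [RHS]mxE; apply: eq_bigr => l _; rewrite [(invmx T)^T _ _]mxE.
by rewrite trmx_inv mulmxK // unitmx_tr.
Qed.

Lemma bracket_congr_mx X Y :
  bracket_mx congr_mx X Y = bracket_mx M (X *m P) (Y *m P) *m invmx T.
Proof.
have uTt : T^T \in unitmx by rewrite unitmx_tr.
apply: rV_dotP => W; rewrite bracket_mxE -[W in LHS](mulmxKV uTt) pencil_congr_mx.
have e : invmx T *m W^T = (W *m invmx T^T)^T by rewrite trmx_mul trmx_inv trmxK.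
by rewrite -[in RHS]mulmxA e bracket_mxE trmx_mul !mulmxA.
Qed.

Lemma two_step_congr_mx u v :
  two_step_bracket (bracket_mx congr_mx) u v =
  two_step_bracket (bracket_mx M) (u *m F) (v *m F) *m invmx F.
Proof.
have uF : F \in unitmx by exact: ublock_unitmx.
have lF (w : 'rV[R]_(m + 2)) : lsubmx (w *m F) = lsubmx w *m P.
  by rewrite -{1}[w]hsubmxK mul_row_block row_mxKl mulmx0 addr0.
apply: (canRL (mulmxK uF)).
rewrite /two_step_bracket !lF bracket_congr_mx mul_row_block !mul0mx !add0r mulmx0.
by rewrite mulmxKV.
Qed.

End Congruence.

(** An adapted orthonormal basis makes the metric standard. The pencil changes by a congruence, and
    replacing each vector f by f P^-1 preserves the chain relations, now between two new independent
    elements of n_2. *)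
Lemma nilsoliton_no_jordan (R : realType) m (M : 'I_2 -> 'M[R]_m)
    (g : {dot 'rV[R]_(m + 2) for idfun}) (a b : R) (f0 f1 e0 e1 : 'rV[R]_m) :
    (forall l, (M l)^T = - M l) ->
    (forall Z, Z != 0 -> pencil M Z \in unitmx) ->
    nilsoliton (two_step_bracket (bracket_mx M)) g -> b != 0 ->
    f0 *m M 0 = (- a *: f0 - b *: f1) *m M 1 ->
    f1 *m M 0 = (b *: f0 - a *: f1) *m M 1 ->
    e0 *m M 0 = (- a *: e0 - b *: e1 + f0) *m M 1 ->
    e1 *m M 0 = (b *: e0 - a *: e1 + f1) *m M 1 ->
  f1 = 0.
Proof.
move=> skM ndM nil b0 f0E f1E e0E e1E.
have [G [sG gE pG]] := dot_gram g.
have [||P [Q [T [uP uT FG]]]] := @posdef_block_basis R m 2 G _ _ (conj sG pG).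
- by move=> A; exact: posdef_basis.
- by move=> A; exact: posdef_basis.
have [g1 g1E] := dot_of_gram (posdef_1mx R (m + 2)).1 (posdef_1mx R (m + 2)).2.
have {}g1E u v : g1 u v = (u *m v^T) 0 0 by rewrite g1E mulmx1.
have g1g u v : g1 u v = g (u *m block_mx P Q 0 T) (v *m block_mx P Q 0 T).
  rewrite g1E gE trmx_mul !mulmxA -(mulmxA u) -(mulmxA u) FG mulmx1 //.
have uF : block_mx P Q 0 T \in unitmx by exact: ublock_unitmx.
have := nilsoliton_transfer uF (two_step_congr_mx M Q uP uT) g1g nil.
have skM' := congr_mx_skew skM P T; set M' := congr_mx M P T in skM' *.
have M'E Z : pencil M' (Z *m T^T) = P *m pencil M Z *m P^T.
  exact: pencil_congr_mx.
have uTt : T^T \in unitmx by rewrite unitmx_tr.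
have ndM' Z : Z != 0 -> pencil M' Z \in unitmx.
  move=> Z0; rewrite -[Z](mulmxKV uTt) M'E !unitmx_mul uP unitmx_tr uP /= andbT.
  by rewrite ndM //; apply: contraNneq Z0 => Z0; rewrite -[Z](mulmxKV uTt) Z0 mul0mx.
move=> /(nilsoliton_stdP skM' g1E)[c /= /(nilsoliton_sqsum_scalar skM' ndM')[kappa sqM']].
have W0 : 'e_1 *m T^T != 0 :> 'rV[R]_2.
  apply/negP => /eqP h; have := congr1 (mulmx^~ (invmx T^T)) h.
  rewrite mulmxK // mul0mx => /rowP /(_ 1); rewrite !mxE => /eqP.
  by rewrite oner_eq0.
have tr (f h : 'rV[R]_m) : f *m M 0 = h *m M 1 ->
  f *m invmx P *m pencil M' ('e_0 *m T^T) = h *m invmx P *m pencil M' ('e_1 *m T^T).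
  by move=> e; rewrite !M'E !pencil_delta !mulmxA !mulmxKV // e.
have /(congr1 (mulmx^~ P)) : f1 *m invmx P = 0.
  apply: (@sqsum_scalar_no_jordan _ _ _ skM' _ sqM' _ ('e_0 *m T^T) a b
    (f0 *m invmx P) _ (e0 *m invmx P) (e1 *m invmx P) b0 W0 (ndM' _ W0));
  by rewrite ?(scalemxAl, =^~ mulmxBl, =^~ mulmxDl);
    apply: tr; rewrite ?f0E ?f1E ?e0E ?e1E.
by rewrite mulmxKV // mul0mx.
Qed.

(** * The blocks A and their Jordan chains *)

Lemma scale_mxdiag (R : pzRingType) p (p_ : 'I_p -> nat) a
    (B : forall i, 'M[R]_(p_ i)) :
  a *: (\mxdiag_i B i) = \mxdiag_i (a *: B i).
Proof.
rewrite /mxdiag; have -> (C : forall i j, 'M[R]_(p_ i, p_ j)) :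
    a *: (\mxblock_(i, j) C i j) = \mxblock_(i, j) (a *: C i j).
  by apply/matrixP => s t; rewrite !mxE.
apply/eq_mxblock => i j.
by case: eqVneq => [->|_]; rewrite ?conform_mx_id ?scaler0.
Qed.

Section ABlock.
Variables (R : realType) (a b : R).

Lemma A_block_sym x y k : (A_block a b x y k)^T = A_block a b x y k.
Proof.
rewrite /A_block tr_mxblock; apply/eq_mxblock => i j; rewrite addnC.
do 2?case: ifP => _; rewrite ?trmx0 //;
  by apply/matrixP; do 2?apply: ord2P; rewrite !mxE.
Qed.

Lemma A_block_linear x y k :
  A_block a b x y k = x *: A_block a b 1 0 k + y *: A_block a b 0 1 k.
Proof.
apply/matrixP => s t; rewrite /A_block !mxE.
do 2?case: ifP => _; rewrite ?mxE /=; do 2?case: ifP => _; ring.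
Qed.

(** The matrix is block triangular with respect to the anti-diagonal, with invertible blocks there,
    so v A = 0 is solved from the last block of [v] backwards. *)
Lemma A_block_unitmx x y k : b != 0 -> (x != 0) || (y != 0) ->
  A_block a b x y k \in unitmx.
Proof.
move=> b0 xy0; apply: ker0_unitmx => v vA.
have C0 (w : 'rV[R]_2) :
    w *m mx22 (- (b * x)) (y - a * x) (y - a * x) (b * x) = 0 -> w = 0.
  (* This number is minus the determinant of the block C. Being symmetric and traceless, C squares
     to this scalar, so multiplying w C = 0 by C isolates [w]. *)
  have N0 : (b * x) ^+ 2 + (y - a * x) ^+ 2 != 0.
    rewrite paddr_eq0 ?sqr_ge0 // !sqrf_eq0 mulf_eq0 (negPf b0) /=.
    by move: xy0; have [->|//] := eqVneq x 0; rewrite /= mulr0 subr0.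
  move=> wC; have e0 := congr1 (fun A : 'rV[R]_2 => A 0 0) wC.
  have e1 := congr1 (fun A : 'rV[R]_2 => A 0 1) wC.
  move: e0 e1; rewrite !mxE !big_ord_recl !big_ord0 !mxE /= !addr0.
  have -> : lift ord0 ord0 = 1 :> 'I_2 by apply/val_inj.
  move=> e0 e1; apply/rowP; apply: ord2P; rewrite zeromxE; apply: (mulIf N0); rewrite mul0r.
    transitivity ((w 0 0 * - (b * x) + w 0 1 * (y - a * x)) * - (b * x)
      + (w 0 0 * (y - a * x) + w 0 1 * (b * x)) * (y - a * x)); first by ring.
    by rewrite e0 e1 !mul0r addr0.
  transitivity ((w 0 0 * - (b * x) + w 0 1 * (y - a * x)) * (y - a * x)
      + (w 0 0 * (y - a * x) + w 0 1 * (b * x)) * (b * x)); first by ring.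
  by rewrite e0 e1 !mul0r addr0.
have step (i : 'I_k) :
    (forall i' : 'I_k, (i < i')%N -> submxrow v i' = 0) -> submxrow v i = 0.
  move=> hi; apply: C0.
  (* In this block column the anti-diagonal entry lies in block row [i]; any other nonzero one lies
     in row [i + 1], where [v] already vanishes. *)
  have : submxrow (v *m A_block a b x y k) (rev_ord i) = 0.
    by rewrite vA submxrow0.
  rewrite -{1}[v]submxrowK mul_mxrow_mxblock mxrowK (bigD1 i) //=.
  have -> : ((i + (k - i.+1)).+1 == k)%N by have := ltn_ord i; lia.
  rewrite big1 ?addr0 // => i' ii'.
  have [lt|] := ltnP i i'; first by rewrite hi // mul0mx.
  rewrite leq_eqVlt (inj_eq val_inj) (negPf ii') /= => lt.
  have ik := ltn_ord i.
  have -> : ((i' + (k - i.+1)).+1 == k)%N = false by lia.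
  have -> : (i' + (k - i.+1) == k)%N = false by lia.
  by rewrite mulmx0.
have v0 n (i : 'I_k) : (k <= i + n)%N -> submxrow v i = 0.
  elim: n i => [|n IHn] i kin; first by have := ltn_ord i; lia.
  by apply: step => i' ii'; apply: IHn; lia.
rewrite -[v]submxrowK; apply/mxrowP => i.
by rewrite mxrowK submxrow0 (v0 k) // leq_addl.
Qed.

Definition block_row p k : 'M[R]_(2, \sum_(j < k) 2) :=
  \mxrow_(j < k) (if (j == p :> nat) then 1%:M else 0).

(** The real form of the eigenvalue - a + ib of J(Z_1) J(Z_2)^-1. *)
Definition rot_mx : 'M[R]_2 := mx22 (- a) (- b) b (- a).

Lemma block_row_mul_A p k x y (pk : (p < k)%N) :
  block_row p k *m A_block a b x y k = \mxrow_(j < k)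
    (if ((p + j).+1 == k)%N then mx22 (- (b * x)) (y - a * x) (y - a * x) (b * x)
     else if (p + j == k)%N then mx22 0 x x 0
     else 0).
Proof.
rewrite mul_mxrow_mxblock; apply: eq_mxrow => j.
rewrite (bigD1 (Ordinal pk)) //= eqxx mul1mx big1 ?addr0 // => i ip.
by case: ifP => [/eqP e|_]; rewrite ?mul0mx //; case/negP: ip; apply/eqP/val_inj.
Qed.

(** With indices from 0, block row 0 meets only the anti-diagonal, and there [rot_mx] times the swap
    matrix, the block for (x, y) = (0, 1), is the block for (1, 0). *)
Lemma block_row0_A k : (0 < k)%N ->
  block_row 0 k *m A_block a b 1 0 k = rot_mx *m block_row 0 k *m A_block a b 0 1 k.
Proof.
move=> k0; rewrite -mulmxA !block_row_mul_A // mul_mxrow; apply: eq_mxrow => j.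
rewrite add0n; case: ifP => _.
  by apply/matrixP; do 2?apply: ord2P;
    rewrite !mxE big_ord_recl big_ord1 !mxE /=; ring.
by rewrite ltn_eqF // mulmx0.
Qed.

(** The additional swap block of row 1, in the last block column, is exactly the anti-diagonal block
    of row 0 for (x, y) = (0, 1). This produces the nilpotent part of the Jordan chain. *)
Lemma block_row1_A k : (1 < k)%N ->
  block_row 1 k *m A_block a b 1 0 k =
  (rot_mx *m block_row 1 k + block_row 0 k) *m A_block a b 0 1 k.
Proof.
move=> k1; rewrite mulmxDl -mulmxA !block_row_mul_A ?(ltnW k1) //.
rewrite mul_mxrow -mxrowD; apply: eq_mxrow => j.
rewrite add0n add1n (ltn_eqF (ltn_ord j)).
have [e|_] := eqVneq j.+2 k.
  have -> : (j.+1 == k) = false by lia.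
  rewrite addr0; apply/matrixP; do 2?apply: ord2P;
    rewrite !mxE big_ord_recl big_ord1 !mxE /=; ring.
case: ifP => _; last by rewrite mulmx0 addr0.
by apply/matrixP; do 2?apply: ord2P;
    rewrite !mxE big_ord_recl big_ord1 !mxE /=; ring.
Qed.

End ABlock.

Lemma mulmx_skew_eq (R : realType) p n (A B : 'M[R]_(p, n)) (J0 J1 : 'M[R]_n) :
  J0^T = - J0 -> J1^T = - J1 -> A *m J0 = B *m J1 -> A *m J0^T = B *m J1^T.
Proof. by move=> -> -> AB; rewrite !mulmxN AB. Qed.

(** * The algebra [mu_S] and the necessity of k_i = 1 *)

Section JS.
Variables (R : realType) (r : nat) (alpha : 'I_r -> R[i]) (k : 'I_r -> nat).

Lemma J_S_skew z : (J_S alpha k z)^T = - J_S alpha k z.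
Proof.
rewrite /J_S tr_mxdiag -mxdiagN; apply: eq_mxdiag => i.
by rewrite /J_block tr_block_mx opp_block_mx !trmx0 linearN /= trmxK !oppr0 opprK.
Qed.

Lemma J_S_linear z : J_S alpha k z = z 0 0 *: J_S alpha k 'e_0 + z 0 1 *: J_S alpha k 'e_1.
Proof.
rewrite /J_S !scale_mxdiag -mxdiagD; apply: eq_mxdiag => i.
rewrite /J_block !scale_block_mx add_block_mx !scaler0 !addr0 !A_block_sym.
by rewrite !scalerN -opprD [in LHS]A_block_linear !mxE.
Qed.

Lemma J_S_unitmx z : (forall i, complex.Im (alpha i) != 0) -> z != 0 ->
  J_S alpha k z \in unitmx.
Proof.
move=> hb z0; have {}z0 : (z 0 0 != 0) || (z 0 1 != 0).
  apply: contraNT z0; rewrite negb_or !negbK => /andP[/eqP z00 /eqP z01].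
  by apply/eqP/rowP; apply: ord2P; rewrite zeromxE.
apply: ker0_unitmx => u; rewrite -[u]submxrowK /J_S mul_mxrow_mxdiag => u0.
apply/mxrowP => i; rewrite submxrow0 mxrowK.
have := congr1 (fun A => submxrow A i) u0; rewrite submxrow0 mxrowK.
rewrite -[submxrow u i]hsubmxK /J_block mul_row_block A_block_sym.
rewrite !mulmx0 add0r addr0 -row_mx0 mulmxN => /eq_row_mx[/eqP].
rewrite oppr_eq0 => /eqP rA lA.
have uA := A_block_unitmx (complex.Re (alpha i)) (k i) (hb i) z0.
by rewrite -[lsubmx _](mulmxK uA) -[rsubmx _](mulmxK uA) rA lA !mul0mx.
Qed.

(** [J_S] acts on columns, whereas the matrices of [bracket_mx] act on rows. *)
Definition M_S (l : 'I_2) := (J_S alpha k 'e_l)^T.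

Lemma M_S_skew l : (M_S l)^T = - M_S l.
Proof. by rewrite /M_S J_S_skew linearN /= J_S_skew. Qed.

Lemma pencil_M_S z : pencil M_S z = (J_S alpha k z)^T.
Proof.
have trD n (A B : 'M[R]_n) x y : (x *: A + y *: B)^T = x *: A^T + y *: B^T.
  by rewrite linearD !linearZ.
have M1 (M : 'I_2 -> 'M[R]_(\sum_(i < r) (\sum_(j < k i) 2 + \sum_(j < k i) 2))) :
    pencil M z = z 0 0 *: M 0 + z 0 1 *: M 1.
  by rewrite /pencil big_ord_recl big_ord1; congr (_ + z _ _ *: M _); apply/val_inj.
by rewrite M1 J_S_linear trD.
Qed.

Lemma mu_S_bracket : mu_S alpha k = two_step_bracket (bracket_mx M_S).
Proof. by []. Qed.

Definition jordan_row p (i : 'I_r) :=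
  \mxrow_(j < r) (if j == i then row_mx (block_row R p (k j)) 0
                  else (0 : 'M[R]_(2, \sum_(l < k j) 2 + \sum_(l < k j) 2))).

(** These rows live in the first half of the i-th block, and J carries that half to the second one
    through A. The coefficients [K0], [K1] cover both sides of the two chain relations at once. *)
Lemma jordan_row_mul (K0 K1 : 'M[R]_2) i z :
  (K0 *m jordan_row 0 i + K1 *m jordan_row 1 i) *m J_S alpha k z =
  \mxrow_(j < r) (if j == i then
     row_mx 0 ((K0 *m block_row R 0 (k j) + K1 *m block_row R 1 (k j)) *m
        A_block (complex.Re (alpha j)) (complex.Im (alpha j)) (z 0 0) (z 0 1) (k j))
   else 0).
Proof.
rewrite /jordan_row !mul_mxrow -mxrowD mul_mxrow_mxdiag; apply: eq_mxrow => j.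
case: ifP => _; last by rewrite !mulmx0 addr0 mul0mx.
rewrite !mul_mx_row !mulmx0 add_row_mx addr0 /J_block mul_row_block.
by rewrite !mulmx0 mul0mx !addr0.
Qed.

(* Otherwise unification unfolds the block matrices and does not terminate in practice. *)
Local Opaque J_S M_S jordan_row A_block block_row.

(** If k_i >= 2, the rows of [E 0] and [E 1] form a real Jordan chain of length two with eigenvalue
    - a + ib, so a soliton would force a standard basis vector to vanish. *)
Lemma admits_nilsoliton_k_le1 :
  (forall i, complex.Im (alpha i) != 0) -> admits_nilsoliton (mu_S alpha k) ->
  forall i, (k i <= 1)%N.
Proof.
move=> hb [g]; rewrite mu_S_bracket => nil i; rewrite leqNgt; apply/negP => ki.
pose a := complex.Re (alpha i); pose b := complex.Im (alpha i).
pose K := rot_mx a b.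
pose E p := jordan_row p i.
have JM (A B : 'M[R]_(2, \sum_(i < r) (\sum_(j < k i) 2 + \sum_(j < k i) 2))) :
    A *m J_S alpha k 'e_0 = B *m J_S alpha k 'e_1 -> A *m M_S 0 = B *m M_S 1.
  exact: mulmx_skew_eq (J_S_skew _) (J_S_skew _).
have E0M : E 0 *m M_S 0 = K *m E 0 *m M_S 1.
  apply: JM.
  have := jordan_row_mul 1%:M 0 i 'e_0; have := jordan_row_mul K 0 i 'e_1.
  rewrite !mul0mx !addr0 !mul1mx => -> ->; apply: eq_mxrow => j.
  case: eqVneq => // ->; rewrite !mxE /= !mul0mx !addr0 mul1mx.
  by rewrite block_row0_A // (ltn_trans _ ki).
have E1M : E 1 *m M_S 0 = (K *m E 1 + E 0) *m M_S 1.
  apply: JM.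
  have := jordan_row_mul 0 1%:M i 'e_0; have := jordan_row_mul 1%:M K i 'e_1.
  rewrite !mul0mx !add0r !mul1mx [K *m E 1 + _]addrC => -> ->; apply: eq_mxrow => j.
  case: eqVneq => [->|_]; last by [].
  rewrite !mxE /= mul0mx add0r !mul1mx (block_row1_A _ _ ki).
  by rewrite [in LHS]addrC.
have eK0 : 'e_0 *m K = - a *: 'e_0 - b *: 'e_1 :> 'rV[R]_2.
  by apply/rowP; apply: ord2P; rewrite !mxE big_ord_recl big_ord1 !mxE /=; ring.
have eK1 : 'e_1 *m K = b *: 'e_0 - a *: 'e_1 :> 'rV[R]_2.
  by apply/rowP; apply: ord2P; rewrite !mxE big_ord_recl big_ord1 !mxE /=; ring.
have ndM Z : Z != 0 -> pencil M_S Z \in unitmx.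
  by move=> Z0; rewrite pencil_M_S unitmx_tr J_S_unitmx.
have f10 : ('e_1 : 'rV[R]_2) *m E 0 = 0.
  apply: (@nilsoliton_no_jordan _ _ _ g a b ('e_0 *m E 0) _ ('e_0 *m E 1) ('e_1 *m E 1)
            M_S_skew ndM nil (hb i));
  rewrite ?(scalemxAl, =^~ mulmxBl, =^~ mulmxDl) -?eK0 -?eK1 -[LHS]mulmxA.
  - by rewrite E0M !mulmxA.
  - by rewrite E0M !mulmxA.
  - by rewrite E1M mulmxDl mulmxDr mulmxDl !mulmxA.
  - by rewrite E1M mulmxDl mulmxDr mulmxDl !mulmxA.
have := congr1 (fun A => submxrow A i) f10.
Transparent jordan_row block_row.
rewrite /E /jordan_row mul_mxrow mxrowK submxrow0 eqxx mul_mx_row mulmx0 -row_mx0.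
move=> /eq_row_mx[/(congr1 (fun A => submxrow A (Ordinal (ltn_trans (ltnSn 0) ki))))].
rewrite /block_row mul_mxrow mxrowK submxrow0 eqxx mulmx1.
by move=> /rowP /(_ 1) /eqP; rewrite !mxE oner_eq0.
Qed.

End JS.

(** * Sufficiency: blocks of size one at a critical point *)

Lemma sqsum_mxE (R : realType) m (M : 'I_2 -> 'M[R]_m) :
  sqsum_mx M = M 0 *m M 0 + M 1 *m M 1.
Proof.
by rewrite /sqsum_mx big_ord_recl big_ord1; congr (_ + M _ *m M _); apply/val_inj.
Qed.

Lemma nilsoliton_of_scalar (R : realType) m (M : 'I_2 -> 'M[R]_m)
    (g : {dot 'rV[R]_(m + 2) for idfun}) (x y : R) :
    (forall l, (M l)^T = - M l) -> (forall u v, g u v = (u *m v^T) 0 0) ->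
    sqsum_mx M = x%:M -> trace_mx M = y%:M ->
  nilsoliton (two_step_bracket (bracket_mx M)) g.
Proof.
(* Here D is x/2 - c on n_1 and - y/4 - c on n_2; a derivation needs the second to be twice the
   first, which determines c. *)
move=> skM gE sqM trM; apply/(nilsoliton_stdP skM gE); exists (x + 4^-1 * y) => /= l.
rewrite sqM trM !scale_scalar_mx -!raddfB /= mul_scalar_mx mul_mx_scalar -scalerDl.
rewrite (bigD1 l) //= mxE eqxx mulr1n big1 ?addr0 => [|j jl].
  by congr (_ *: _); lra.
by rewrite mxE (negPf jl) mulr0n scale0r.
Qed.

(** The inner product is the one for which the rows of [block_mx P 0 0 T] are orthonormal. *)
Lemma admits_nilsoliton_of_congr_mx (R : realType) m (M : 'I_2 -> 'M[R]_m)
    (P : 'M[R]_m) (T : 'M[R]_2) (x y : R) : (forall l, (M l)^T = - M l) ->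
    P \in unitmx -> T \in unitmx ->
    sqsum_mx (congr_mx M P T) = x%:M -> trace_mx (congr_mx M P T) = y%:M ->
  admits_nilsoliton (two_step_bracket (bracket_mx M)).
Proof.
move=> skM uP uT sqM trM.
have [g1 g1E] := dot_of_gram (posdef_1mx R (m + 2)).1 (posdef_1mx R (m + 2)).2.
have {}g1E u v : g1 u v = (u *m v^T) 0 0 by rewrite g1E mulmx1.
have nil := nilsoliton_of_scalar (congr_mx_skew skM P T) g1E sqM trM.
have uF : block_mx P 0 0 T \in unitmx by exact: ublock_unitmx.
have uFi : invmx (block_mx P 0 0 T) \in unitmx by rewrite unitmx_inv.
have [sG pG] := posdef_congr uFi (posdef_1mx R (m + 2)).
have [g gE] := dot_of_gram sG pG; exists g.
apply: nilsoliton_transfer uFi _ _ nil => u v.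
  by rewrite (two_step_congr_mx M 0 uP uT) !mulmxKV // invmxK mulmxKV.
by rewrite gE g1E mulmx1 trmx_mul !mulmxA.
Qed.

Lemma mul_mxdiag (R : pzSemiRingType) p (p_ : 'I_p -> nat)
    (A B : forall i, 'M[R]_(p_ i)) :
  (\mxdiag_i A i) *m (\mxdiag_i B i) = \mxdiag_i (A i *m B i).
Proof.
rewrite {2}/mxdiag mul_mxdiag_mxblock; apply/eq_mxblock => i j.
by case: eqVneq => [->|_]; rewrite ?conform_mx_id ?mulmx0.
Qed.

(** Polarization of the symmetric form tr(AB). *)
Lemma mxtrace_mul_polar (R : realType) n (A B : 'M[R]_n) (x y z : R) :
    A *m A = x%:M -> B *m B = y%:M -> (A + B) *m (A + B) = z%:M ->
  \tr (A *m B) = n%:R * (z - x - y) / 2.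
Proof.
move=> A2 B2; rewrite mulmxDl !mulmxDr A2 B2 => /(congr1 mxtrace).
by rewrite !mxtraceD (mxtrace_mulC B A) !mxtrace_scalar -(mulr_natl x)
  -(mulr_natl y) -(mulr_natl z); lra.
Qed.

Section SizeOne.
Variable R : realType.

(** For alpha = a + ib this is the real inner product of the complex numbers z_2 - alpha z_1 and w_2
    - alpha w_1 (indices from 1). *)
Definition quad_form (a b : R) (z w : 'rV[R]_2) : R :=
  b ^+ 2 * z 0 0 * w 0 0 + (z 0 1 - a * z 0 0) * (w 0 1 - a * w 0 0).

Lemma A_block1_sqr (a b x y : R) :
  A_block a b x y 1 *m A_block a b x y 1 = ((b * x) ^+ 2 + (y - a * x) ^+ 2)%:M.
Proof.
rewrite -mxdiagZ /A_block mul_mxblock; apply/eq_mxblock => i j.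
rewrite big_ord1 !ord1 eqxx conform_mx_id /=.
by apply/matrixP; do 2?apply: ord2P;
  rewrite !mxE big_ord_recl big_ord1 !mxE /=; ring.
Qed.

Lemma J_block1_sqr (al : R[i]) z :
  J_block al 1 z *m J_block al 1 z =
  (- quad_form (complex.Re al) (complex.Im al) z z)%:M.
Proof.
rewrite /J_block mulmx_block A_block_sym !mulmx0 !mul0mx !addr0 !add0r.
rewrite mulmxN mulNmx A_block1_sqr -raddfN /= -scalar_mx_block.
by congr (_%:M); rewrite /quad_form; ring.
Qed.

Lemma J_blockD (al : R[i]) k z w : J_block al k (z + w) = J_block al k z + J_block al k w.
Proof.
rewrite /J_block add_block_mx !addr0 !A_block_sym -opprD.
rewrite !(A_block_linear _ _ ((z + w) _ _)).
rewrite !(A_block_linear _ _ (z _ _)) !(A_block_linear _ _ (w _ _)).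
by congr block_mx; [|congr (- _)]; rewrite !addmxE !scalerDl addrACA.
Qed.

Lemma mxtrace_J_block1 (al : R[i]) z w :
  \tr (J_block al 1 z *m J_block al 1 w) =
  - (\sum_(i < 1) 2 + \sum_(i < 1) 2)%:R *
    quad_form (complex.Re al) (complex.Im al) z w.
Proof.
have := J_block1_sqr al (z + w); rewrite J_blockD.
move=> /(mxtrace_mul_polar (J_block1_sqr al z) (J_block1_sqr al w)) ->.
by rewrite /quad_form !addmxE; field.
Qed.

End SizeOne.

Section Sufficiency.
Variables (R : realType) (r : nat) (alpha : 'I_r -> R[i]) (s t : R).
Hypothesis (halpha : forall i, complex.Im (alpha i) != 0) (t0 : 0 < t).

Let a i := complex.Re (alpha i).
Let b i := complex.Im (alpha i).
Let N i := t ^+ 2 + ((s - a i) ^+ 2 + b i ^+ 2).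

Hypothesis crit_s : \sum_i (s - a i) / N i = 0.
Hypothesis crit_t : \sum_i t ^+ 2 / N i = \sum_i ((s - a i) ^+ 2 + b i ^+ 2) / N i.

Let N_gt0 i : 0 < N i.
Proof. by rewrite /N ltr_pwDl ?exprn_gt0 // addr_ge0 ?sqr_ge0. Qed.

(* J(z 0)^2 and J(z 1)^2 are - t^2 and - ((s - a i)^2 + (b i)^2) on the i-th block;
   rescaling that block by N i makes them add up to -1, and the two equations for
   (s, t) say that the rescaled J(z 0), J(z 1) are orthogonal of equal norm. *)
Let k (i : 'I_r) := 1%N.
Let z (l : 'I_2) : 'rV[R]_2 :=
  \row_j (if l == 0 then (if j == 0 then 0 else t) else (if j == 0 then 1 else s)).
Let U : 'M[R]_2 := \matrix_(j, l) z l 0 j.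
(** [P] scales by the square root of [q i], so J is multiplied by [q i] and a product of two J by 1
    / N i. *)
Let q i := (Num.sqrt (N i))^-1.
Let P := \mxdiag_(i < r) ((Num.sqrt (q i))%:M : 'M[R]_(\sum_(j < 1) 2 + \sum_(j < 1) 2)).

Let q_gt0 i : 0 < q i. Proof. by rewrite /q invr_gt0 sqrtr_gt0. Qed.

Let q_sqr i : q i ^+ 2 = (N i)^-1.
Proof. by rewrite /q exprVn sqr_sqrtr // ltW. Qed.

Let U_unitmx : U \in unitmx.
Proof.
apply: ker0_unitmx => v vU.
have := congr1 (fun A : 'rV[R]_2 => A 0 0) vU; have := congr1 (fun A : 'rV[R]_2 => A 0 1) vU.
rewrite !mxE !big_ord_recl !big_ord0 !mxE /= !addr0 mulr0 mulr1 add0r.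
move=> e1 /eqP; rewrite mulf_eq0 (gt_eqF t0) orbF => /eqP v1.
move: e1; rewrite v1 mul0r addr0 => v0.
apply/rowP; apply: ord2P; rewrite zeromxE // -[RHS]v1.
by congr (v _ _); apply/val_inj.
Qed.

Let P_unitmx : P \in unitmx.
Proof.
have PP : P *m \mxdiag_(i < r) ((Num.sqrt (q i))^-1%:M :
    'M[R]_(\sum_(j < 1) 2 + \sum_(j < 1) 2)) = 1%:M.
  rewrite mul_mxdiag -mxdiagZ; apply: eq_mxdiag => i.
  by rewrite -scalar_mxM mulfV // gt_eqF // sqrtr_gt0.
by have [] := mulmx1_unit PP.
Qed.

(** With [invmx U] in the role of T, the new structure matrices are the congruent images of J(z 0)
    and J(z 1). The sign comes from transposing J. *)
Let congrE l : congr_mx (M_S alpha k) P (invmx U) l =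
  \mxdiag_i (- q i *: J_block (alpha i) 1 (z l)).
Proof.
have -> : congr_mx (M_S alpha k) P (invmx U) l = P *m pencil (M_S alpha k) (z l) *m P^T.
  rewrite /congr_mx invmxK /pencil mulmx_sumr mulmx_suml; apply: eq_bigr => j _.
  by rewrite -scalemxAr -scalemxAl mxE.
rewrite pencil_M_S J_S_skew -mxdiagN tr_mxdiag !mul_mxdiag; apply: eq_mxdiag => i.
rewrite tr_scalar_mx mul_mx_scalar mul_scalar_mx scalerA scalerN scaleNr.
by rewrite -expr2 sqr_sqrtr // ltW.
Qed.

Let congr_mul l l' : congr_mx (M_S alpha k) P (invmx U) l *m congr_mx (M_S alpha k) P (invmx U) l'
  = \mxdiag_i ((N i)^-1 *: (J_block (alpha i) 1 (z l) *m J_block (alpha i) 1 (z l'))).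
Proof.
rewrite !congrE mul_mxdiag; apply: eq_mxdiag => i.
by rewrite -scalemxAl -scalemxAr scalerA mulrNN -expr2 q_sqr.
Qed.

Let zE : ((z 0 0 0 = 0) * (z 0 0 1 = t) * (z 1 0 0 = 1) * (z 1 0 1 = s))%type.
Proof. by rewrite !mxE. Qed.

Lemma admits_nilsoliton_k1 : admits_nilsoliton (mu_S alpha (fun=> 1%N)).
Proof.
(* [d] is the dimension 4 of a block. The two scalars are the sum of the rescaled squares and the
   common trace of each of them. *)
pose d : R := (\sum_(i < 1) 2 + \sum_(i < 1) 2)%:R.
rewrite mu_S_bracket; apply: (@admits_nilsoliton_of_congr_mx _ _ _ P (invmx U) (- 1)
  (- d * \sum_i t ^+ 2 / N i)).
- exact: M_S_skew.
- exact: P_unitmx.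
- by rewrite unitmx_inv U_unitmx.
- rewrite sqsum_mxE !congr_mul -mxdiagD -mxdiagZ; apply: eq_mxdiag => i.
  rewrite !J_block1_sqr !scale_scalar_mx -raddfD /=; congr (_%:M).
  have -> : (N i)^-1 = - (- quad_form (a i) (b i) (z 0) (z 0)
                          - quad_form (a i) (b i) (z 1) (z 1))^-1.
    by rewrite -opprD invrN opprK /quad_form !zE /N; congr (_^-1); ring.
  rewrite -mulrDr mulNr mulVf // -opprD oppr_eq0 gt_eqF //.
  rewrite (_ : _ + _ = N i) //; rewrite /quad_form !zE /N; ring.
have trE l l' : trace_mx (congr_mx (M_S alpha k) P (invmx U)) l l' =
    - d * \sum_i quad_form (a i) (b i) (z l) (z l') / N i.
  rewrite mxE congr_mul mxtrace_mxdiag mulr_sumr; apply: eq_bigr => i _.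
  by rewrite mxtraceZ mxtrace_J_block1 -/d; ring.
have tr01 : \sum_i quad_form (a i) (b i) (z 0) (z 1) / N i = 0.
  transitivity (t * \sum_i (s - a i) / N i); last by rewrite crit_s mulr0.
  rewrite mulr_sumr; apply: eq_bigr => i _.
  by rewrite /quad_form !zE; ring.
apply/matrixP; apply: ord2P; apply: ord2P; rewrite trE [RHS]mxE /= ?mulr1n ?mulr0n.
- by congr (_ * _); apply: eq_bigr => i _; rewrite /quad_form !zE; congr (_ / _); ring.
- by rewrite tr01 mulr0.
- transitivity (- d * \sum_i quad_form (a i) (b i) (z 0) (z 1) / N i); last first.
    by rewrite tr01 mulr0.
  by congr (_ * _); apply: eq_bigr => i _; rewrite /quad_form; congr (_ / _); ring.
rewrite crit_t; congr (_ * _); apply: eq_bigr => i _.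
by rewrite /quad_form !zE; congr (_ / _); ring.
Qed.

End Sufficiency.

(* Existence of the critical point *)
From mathcomp Require Import boolp classical_sets functions.
From mathcomp Require Import set_interval topology normedtype derive.

Import numFieldNormedType.Exports.

Section CriticalPoint.
Variables (R : realType) (r : nat) (a b : 'I_r -> R).
Hypothesis (r0 : (0 < r)%N) (b0 : forall i, b i != 0).

Let N (s t : R) i := t ^+ 2 + ((s - a i) ^+ 2 + b i ^+ 2).
Let F (p : R * R) := \prod_i (N p.1 p.2 i / p.2).

Let N_gt0 s t i : 0 < N s t i.
Proof.
by rewrite /N ltr_wpDl ?sqr_ge0 // ltr_wpDl ?sqr_ge0 // lt_def sqr_ge0 sqrf_eq0 b0.
Qed.

Let F_continuous (p : R * R) : p.2 != 0 -> {for p, continuous F}.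
Proof.
move=> p2; rewrite /F; elim: (index_enum _) => [|i l IH].
  rewrite (_ : (fun _ => _) = cst 1); first exact: cvg_cst.
  by apply/funext => x; rewrite big_nil.
rewrite (_ : (fun _ => _) = (fun x : R * R => N x.1 x.2 i / x.2) \*
  (fun x : R * R => \prod_(j <- l) (N x.1 x.2 j / x.2))); last first.
  by apply/funext => x; rewrite big_cons.
apply: continuousM => //; apply: continuousM; last first.
  by apply: continuousV => //; exact: cvg_snd.
have cs : {for p, continuous (fun x : R * R => x.1 - a i)}.
  by apply: continuousB; [exact: cvg_fst|exact: cvg_cst].
rewrite (_ : (fun _ => _) = (fun x : R * R => x.2 * x.2
  + ((x.1 - a i) * (x.1 - a i) + b i ^+ 2))); last first.
  by apply/funext => x; rewrite /N !expr2.
apply: continuousD; first by apply: continuousM; exact: cvg_snd.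
apply: continuousD; last exact: cvg_cst.
exact: continuousM.
Qed.

(** One constant dominating 1, a_i^2, b_i^2 and 1 / b_i^2 for all i, and also every factor of [F] at
    (0, 1). *)
Let K := \sum_i (1 + a i ^+ 2 + b i ^+ 2 + (b i ^+ 2)^-1).

Let K_ge i : 1 + a i ^+ 2 + b i ^+ 2 + (b i ^+ 2)^-1 <= K.
Proof.
rewrite /K (bigD1 i) //= lerDl sumr_ge0 // => j _.
by rewrite !addr_ge0 ?sqr_ge0 ?invr_ge0 ?sqr_ge0.
Qed.

Let K_ge1 : 1 <= K.
Proof.
have := K_ge (Ordinal r0); have := sqr_ge0 (a (Ordinal r0)).
have := sqr_ge0 (b (Ordinal r0)); have : 0 <= (b (Ordinal r0) ^+ 2)^-1.
  by rewrite invr_ge0 sqr_ge0.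
lra.
Qed.

(** If t > K then t^2 / t suffices; if t < K^-2 then b_i^2 / t > K^2 b_i^2 >= K; otherwise |s| > 2K
    and |a_i| < K give (s - a_i)^2 > K^2 >= K t. *)
Let factor_gtK s t i : 0 < t ->
  ~~ ((- (2 * K) <= s <= 2 * K) && (K ^- 2 <= t <= K)) -> K < N s t i / t.
Proof.
move=> t0 out; have K0 : 0 < K by apply: lt_le_trans K_ge1.
have bp : 0 < b i ^+ 2 by rewrite lt_def sqr_ge0 sqrf_eq0 b0.
have bi : 1 <= K * b i ^+ 2.
  have : (b i ^+ 2)^-1 <= K.
    by apply: le_trans (K_ge i); rewrite lerDr !addr_ge0 ?sqr_ge0.
  by rewrite -ler_pdivrMr // div1r.
have aK : a i ^+ 2 + 1 <= K.
  apply: le_trans (K_ge i); have : 0 <= (b i ^+ 2)^-1 by rewrite invr_ge0 sqr_ge0.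
  lra.
rewrite ltr_pdivlMr // /N.
have [tK|tK] := ltP K t; first by have := sqr_ge0 (s - a i); nra.
have [tk|tk] := ltP t (K ^- 2).
  have : t * K ^+ 2 < 1 by rewrite -ltr_pdivlMr ?exprn_gt0 // div1r.
  have := sqr_ge0 (s - a i); have := sqr_ge0 t; nra.
have [sK|sK] := ltP (2 * K) s.
  have : K < s - a i by nra.
  by have := sqr_ge0 t; nra.
have [sk|sk] := ltP s (- (2 * K)).
  have : s - a i < - K by nra.
  by have := sqr_ge0 t; nra.
by move: out; rewrite sk sK tk tK.
Qed.

(** [F] attains a minimum on a compact rectangle containing (0, 1). Outside it every factor exceeds
    [K], hence the corresponding factor at (0, 1). *)
Let F_min : exists2 p : R * R, 0 < p.2 & forall s t, 0 < t -> F p <= F (s, t).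
Proof.
have K0 : 0 < K by apply: lt_le_trans K_ge1.
pose A := (`[- (2 * K), 2 * K] `*` `[K ^- 2, K])%classic : set (R * R).
have AP (p : R * R) : A p = ((- (2 * K) <= p.1 <= 2 * K) && (K ^- 2 <= p.2 <= K)) :> Prop.
  by rewrite propeqE /A /= !in_itv /=; split => [[-> ->]//|/andP[-> ->]].
have A1 : A (0, 1).
  rewrite AP /= K_ge1 andbT invf_le1 ?exprn_gt0 // exprn_ege1 // andbT.
  by rewrite oppr_le0 !mulr_ge0 // ltW.
have Kpos : 0 < K ^- 2 by rewrite invr_gt0 exprn_gt0.
have cA : compact A by apply: compact_setX; exact: segment_compact.
have cF : {within A, continuous F}%classic.
  apply: continuous_in_subspaceT => p; rewrite inE AP => /andP[_ /andP[p2 _]].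
  by apply: F_continuous; rewrite gt_eqF // (lt_le_trans Kpos).
have [p pA pmin] := compact_EVT_min (ex_intro _ _ A1) cA cF.
have : A p by exact: set_mem.
rewrite AP => /andP[_ /andP[p2 _]].
exists p; first exact: lt_le_trans p2.
move=> s t t0.
have [st|out] := boolP ((- (2 * K) <= s <= 2 * K) && (K ^- 2 <= t <= K)).
  have Ast : A (s, t) by rewrite AP.
  by apply: pmin; exact: mem_set.
apply: le_trans (pmin (0, 1) (mem_set A1)) _.
apply: ler_prod => i _; rewrite /= divr1 ltW ?N_gt0 //=.
apply: le_trans (ltW (factor_gtK i t0 out)); apply: le_trans (K_ge i).
rewrite /N expr1n sub0r sqrrN; have : 0 <= (b i ^+ 2)^-1 by rewrite invr_ge0 sqr_ge0.
lra.
Qed.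

(* AM-GM turns minimality of the product into the linear-algebraic statement that
   a quadratic function of (s', t') is minimal at (s, t). *)
Lemma exists_critical_point : exists s t, [/\ 0 < t,
  \sum_i (s - a i) / N s t i = 0 &
  \sum_i t ^+ 2 / N s t i = \sum_i ((s - a i) ^+ 2 + b i ^+ 2) / N s t i].
Proof.
have [[s t] /= t0 Fmin] := F_min; exists s, t.
have Np i : N s t i != 0 by rewrite gt_eqF.
have rR : 0 < r%:R :> R by rewrite ltr0n.
have quad s' t' : 0 < t' -> r%:R * (t' / t) <= \sum_i N s' t' i / N s t i.
  move=> t'0; pose E i := (N s' t' i / t') / (N s t i / t).
  have E0 i : 0 < E i by rewrite !divr_gt0.
  have prodE : 1 <= \prod_i E i.
    rewrite /E big_split /= prodfV ler_pdivlMr ?mul1r; first exact: Fmin.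
    by apply: prodr_gt0 => i _; rewrite divr_gt0.
  have agm : \prod_i E i <= ((\sum_i E i) / r%:R) ^+ r.
    have := (@leif_AGM R _ (fun=> true) E (fun i _ => ltW (E0 i))).1.
    by rewrite card_ord.
  have mean : 1 <= (\sum_i E i) / r%:R.
    rewrite -(expr_ge1 r0) ?(le_trans prodE agm) //.
    by rewrite divr_ge0 ?ler0n // sumr_ge0 // => i _; exact: ltW.
  have -> : \sum_i N s' t' i / N s t i = (\sum_i E i) * (t' / t).
    rewrite mulr_suml; apply: eq_bigr => i _; rewrite /E; field.
    by rewrite Np !gt_eqF.
  rewrite ler_pM2r ?divr_gt0 //.
  by move: mean; rewrite ler_pdivlMr // mul1r.
set S0 := \sum_i (N s t i)^-1.
have S0p : 0 < S0.
  have i0 := Ordinal r0; rewrite /S0 (bigD1 i0) //= ltr_wpDr ?invr_gt0 //.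
  by rewrite sumr_ge0 // => i _; rewrite invr_ge0 ltW.
have sumN : \sum_i N s t i / N s t i = r%:R.
  by under eq_bigr => i _ do rewrite divff //; rewrite sumr_const card_ord.
set S1 := \sum_i (s - a i) / N s t i.
have ineqs h : 0 <= 2 * h * S1 + h ^+ 2 * S0.
  have := quad (s + h) t t0; rewrite divff ?gt_eqF // mulr1 -{1}sumN.
  have -> : \sum_i N (s + h) t i / N s t i
      = \sum_i N s t i / N s t i + (2 * h * S1 + h ^+ 2 * S0).
    rewrite /S1 /S0 !mulr_sumr -!big_split /=; apply: eq_bigr => i _.
    by rewrite mulrA -!mulrDl; congr (_ / _); rewrite /N; ring.
  by rewrite lerDl.
have ineqt h : - t < h -> r%:R * h / t <= (2 * t * h + h ^+ 2) * S0.
  rewrite -subr_gt0 opprK => ht; have := quad s (h + t) ht.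
  have -> : \sum_i N s (h + t) i / N s t i
      = \sum_i N s t i / N s t i + (2 * t * h + h ^+ 2) * S0.
    rewrite /S0 mulr_sumr -big_split /=; apply: eq_bigr => i _.
    by rewrite -mulrDl; congr (_ / _); rewrite /N; ring.
  by rewrite sumN mulrDl divff ?gt_eqF // mulrDr mulr1 addrC lerD2l mulrA.
have S1_0 : S1 = 0.
  (* The vertex of the parabola, where the value is negative unless [S1] vanishes. *)
  have := ineqs (- S1 / S0).
  have -> : 2 * (- S1 / S0) * S1 + (- S1 / S0) ^+ 2 * S0 = - (S1 ^+ 2 / S0).
    by field; rewrite gt_eqF.
  rewrite oppr_ge0 pmulr_lle0 ?invr_gt0 // => S1n; apply/eqP.
  by rewrite -sqrf_eq0 eq_le S1n sqr_ge0.
have S0E : 2 * t ^+ 2 * S0 = r%:R.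
  (* The linear coefficient in h of the inequality [ineqt]. The vertex - c / (2 S0) is admissible
     because it exceeds - t. *)
  pose c := 2 * t * S0 - r%:R / t.
  have hE : - t < - c / (2 * S0).
    have -> : - c / (2 * S0) = - t + r%:R / (2 * t * S0).
      by rewrite /c; field; rewrite !gt_eqF.
    by rewrite ltrDl divr_gt0 // !mulr_gt0.
  have := ineqt _ hE; rewrite -subr_ge0.
  have -> : (2 * t * (- c / (2 * S0)) + (- c / (2 * S0)) ^+ 2) * S0
      - r%:R * (- c / (2 * S0)) / t = - (c ^+ 2 / (4 * S0)).
    by rewrite /c; field; rewrite !gt_eqF.
  rewrite oppr_ge0 pmulr_lle0 ?invr_gt0 ?mulr_gt0 // => cn.
  have /eqP : c == 0 by rewrite -sqrf_eq0 eq_le cn sqr_ge0.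
  rewrite /c => /(congr1 ( *%R t)); rewrite mulr0 mulrBr => /eqP.
  rewrite subr_eq0 => /eqP e; rewrite expr2; transitivity (t * (2 * t * S0)); first ring.
  by rewrite e mulrCA divff ?mulr1 // gt_eqF.
split=> //.
(* The two sums add up to r and, by [S0E], the first is r/2. *)
have : \sum_i t ^+ 2 / N s t i + \sum_i ((s - a i) ^+ 2 + b i ^+ 2) / N s t i = r%:R.
  by rewrite -sumN -big_split /=; apply: eq_bigr => i _; rewrite -mulrDl.
have -> : \sum_i t ^+ 2 / N s t i = t ^+ 2 * S0 by rewrite mulr_sumr.
move=> e; apply: (addrI (t ^+ 2 * S0)); rewrite e -S0E; ring.
Qed.

End CriticalPoint.

Theorem theorem1p2 (R : realType) (r : nat) (alpha : 'I_r -> R[i])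
    (k : 'I_r -> nat)
    (hr : (0 < r)%N)
    (halpha : forall i, complex.Im (alpha i) != 0)
    (hk : forall i, (0 < k i)%N) :
  admits_nilsoliton (mu_S alpha k) <-> (forall i, k i = 1%N).
Proof.
split=> [adm i|k1].
  by apply/eqP; rewrite eqn_leq hk andbT (admits_nilsoliton_k_le1 halpha adm).
(* The dimension of the algebra depends on [k], so [k] is replaced as a function rather than
   pointwise. *)
have -> : k = fun=> 1%N by apply/funext.
have [s [t [t0 crit_s crit_t]]] :=
  exists_critical_point (fun i => complex.Re (alpha i)) hr halpha.
exact: admits_nilsoliton_k1 t0 crit_s crit_t.
Qed.
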